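(* Let $0<t<\pi/2$ and $\lambda\in\mathbb{R}$, and let $f$ be a conformal mapping of the unit disk $\mathbb{D}$ onto a domain $D\ni 0$ bounded by a symmetric circular quadrilateral $P$ with vertices $\pm A,\pm\overline{A}$ ($\operatorname{Re}A>0$, $\operatorname{Im}A>0$), such that $f(e^{it})=A$, $f(0)=0$, $f'(0)=1$, $f''(0)=0$, and the Schwarzian derivative of $f$ is $\mathcal{S}_f=R_{t,\lambda}=2\psi_0-2\lambda\psi_1$. Let $y$ be the solution in $\mathbb{D}$ of $y''+\psi_0 y=\lambda\psi_1 y$ with $y(0)=1$, $y'(0)=0$. Then $$f(z)=\int_0^z\frac{1}{y(\zeta)^2}\,d\zeta\qquad(z\in\mathbb{D}),$$ and the curvature $\kappa$ of the right edge of $P$ is $$\kappa=y(1)^2-2\,y(1)\,y'(1).$$ Consequently, the restriction of $y$ to the real interval $[0,1]$ solves the boundary value problem $$y''+\psi_0y=\lambda\psi_1y,\qquad y(0)=1,\qquad y'(0)=0,\qquad y(1)^2-2y(1)y'(1)=\kappa .$$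
   Context: A symmetric circular quadrilateral is a Jordan curve $P$ in $\mathbb{C}$ formed of four circular arcs (or straight segments) with all four internal angles equal to $\pi/2$, with vertices of the form $\pm A,\pm\overline{A}$ where $\operatorname{Re}A>0$, $\operatorname{Im}A>0$. Its right edge is the one joining $\overline A$ to $A$; it is the image under (the boundary extension of) $f$ of the arc $\{e^{i\theta}:-t\le\theta\le t\}$. The Schwarzian derivative is $\mathcal{S}_f=(f''/f')'-\tfrac12(f''/f')^2$. With $a=e^{it}$, $$\psi_0(z)=\frac34\left(\frac{a^2}{(z^2-a^2)^2}+\frac{\overline a^2}{(z^2-\overline a^2)^2}\right),\qquad \psi_1(z)=-i\left(\frac1{z^2-a^2}-\frac1{z^2-\overline a^2}\right)=\frac{2\sin 2t}{z^4-2(\cos 2t)z^2+1}.$$ The mapping $f$ and the solution $y$ extend analytically to a neighborhood of $z=1$. The (signed) curvature of the right edge is $\kappa=1/r$, where the signed radius $r$ is given by $r=\dfrac{f'(1)^2}{f'(1)+f''(1)}$, i.e. $\kappa=\dfrac{f'(1)+f''(1)}{f'(1)^2}$ (equal to $0$ when the edge is a straight segment). *)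

(* Defs.v *)
From Stdlib Require Import Reals.
From Coquelicot Require Import Coquelicot.

Local Open Scope R_scope.

Definition unit_disk (z : C) : Prop := Cmod z < 1.
Definition closed_unit_disk (z : C) : Prop := Cmod z <= 1.

Definition expi (theta : R) : C := (cos theta, sin theta).

(* Analyticity at [z] means a convergent power series expansion on a whole
   neighborhood of [z]; in particular it constrains [f] on that neighborhood. *)
Definition analytic_at (f : C -> C) (z : C) : Prop :=
  exists (a : nat -> C) (r : R), 0 < r /\
    forall w : C, Cmod (w - z)%C < r ->
      is_pseries (K := C_AbsRing) (V := C_NormedModule) a (w - z)%C (f w).

Definition C_differentiable (f : C -> C) (z : C) : Prop :=
  ex_derive (K := C_AbsRing) (V := C_NormedModule) f z.

Definition schwarzian (f : C -> C) (z : C) : C :=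
  let N := fun w : C => (C_derive (C_derive f) w / C_derive f w)%C in
  (C_derive N z - / 2 * N z ^ 2)%C.

Definition conformal_from_disk (f : C -> C) (D : C -> Prop) : Prop :=
  (forall z, unit_disk z -> analytic_at f z) /\
  (forall z w, unit_disk z -> unit_disk w -> f z = f w -> z = w) /\
  (forall w, D w <-> exists z, unit_disk z /\ f z = w).

Definition is_segment_integral (g : C -> C) (z0 z1 I : C) : Prop :=
  is_RInt (V := C_R_NormedModule)
    (fun s : R => g (z0 + RtoC s * (z1 - z0))%C * (z1 - z0))%C 0 1 I.

Definition connected (D : C -> Prop) : Prop :=
  forall U V : C -> Prop, open U -> open V ->
    (forall z, D z -> U z \/ V z) ->
    (exists z, D z /\ U z) -> (exists z, D z /\ V z) ->
    exists z, D z /\ U z /\ V z.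

Definition boundary (D : C -> Prop) (z : C) : Prop :=
  forall eps : R, 0 < eps ->
    (exists w, D w /\ Cmod (w - z)%C < eps) /\
    (exists w, ~ D w /\ Cmod (w - z)%C < eps).

(* For a Jordan curve [P] this says that [D] is the inside of [P]. *)
Definition domain_bounded_by (D P : C -> Prop) : Prop :=
  open D /\ connected D /\ (exists M : R, forall z, D z -> Cmod z <= M) /\
  (forall z, P z <-> boundary D z).

(* [Arc c rho phi delta] is the arc of the circle of center [c] and radius
   [rho] starting at angle [phi] and swept through the signed angle [delta]. *)
Inductive edge : Type :=
  | Segment (p q : C)
  | Arc (c : C) (rho phi delta : R).

Definition edge_proper (e : edge) : Prop :=
  match e with
  | Segment p q => p <> q
  | Arc _ rho _ delta => 0 < rho /\ 0 < Rabs delta < 2 * PI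
  end.

Definition edge_point (e : edge) (s : R) : C :=
  match e with
  | Segment p q => (p + RtoC s * (q - p))%C
  | Arc c rho phi delta => (c + RtoC rho * expi (phi + s * delta))%C
  end.

(* Derivative of [edge_point e] with respect to the parameter. *)
Definition edge_velocity (e : edge) (s : R) : C :=
  match e with
  | Segment p q => (q - p)%C
  | Arc _ rho phi delta =>
      (RtoC (rho * delta) * Ci * expi (phi + s * delta))%C
  end.

Definition on_edge (e : edge) (z : C) : Prop :=
  exists s : R, 0 <= s <= 1 /\ edge_point e s = z.

(* Signed curvature for the orientation of increasing parameter: positive when
   the edge turns left.  On the boundary of a domain lying to its left, this is
   positive when the edge bulges outwards. *)
Definition edge_curvature (e : edge) : R :=
  match e with
  | Segment _ _ => 0
  | Arc _ rho _ delta => sign delta / rho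
  end.

(* Directions [u * expi phi], [0 < phi < beta], at [v] point into [D], and
   rotating [u] counterclockwise by [beta] gives the direction of [w]. *)
Definition sector_in (D : C -> Prop) (v u w : C) (beta : R) : Prop :=
  (exists k : R, 0 < k /\ w = (RtoC k * expi beta * u)%C) /\
  (forall phi : R, 0 < phi < beta ->
     exists eps : R, 0 < eps /\
       forall s : R, 0 < s < eps -> D (v + RtoC s * (u * expi phi))%C).

(* [u], [w] are the tangent vectors at the corner [v] of the two sides leaving
   [v]; no orientation of the boundary is presupposed. *)
Definition internal_angle (D : C -> Prop) (v u w : C) (beta : R) : Prop :=
  sector_in D v u w beta \/ sector_in D v w u beta.

(* The vertices in cyclic order, starting at the lower right one. *)
Definition vertex (A : C) (k : nat) : C :=
  match Nat.modulo k 4 with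
  | 0%nat => Cconj A
  | 1%nat => A
  | 2%nat => (- Cconj A)%C
  | _ => (- A)%C
  end.

(* Only [e 0], ..., [e 3] (right, top, left, bottom edge) are relevant. *)
Definition quad_curve (e : nat -> edge) (z : C) : Prop :=
  exists k : nat, (k < 4)%nat /\ on_edge (e k) z.

Definition right_edge (e : nat -> edge) : edge := e 0%nat.

Definition symmetric_circular_quadrilateral
    (A : C) (e : nat -> edge) (D : C -> Prop) : Prop :=
  0 < Re A /\ 0 < Im A /\
  (forall k, (k < 4)%nat ->
     edge_proper (e k) /\
     edge_point (e k) 0 = vertex A k /\
     edge_point (e k) 1 = vertex A (S k)) /\
  (forall j k s s', (j < 4)%nat -> (k < 4)%nat ->
     0 <= s < 1 -> 0 <= s' < 1 ->
     edge_point (e j) s = edge_point (e k) s' -> j = k /\ s = s') /\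
  domain_bounded_by D (quad_curve e) /\
  (forall k, (k < 4)%nat ->
     internal_angle D (vertex A (S k))
       (edge_velocity (e (Nat.modulo (S k) 4)) 0)
       (- edge_velocity (e k) 1)%C (PI / 2)).

Definition psi0 (t : R) (z : C) : C :=
  let a := expi t in
  (3 / 4 * (a ^ 2 / (z ^ 2 - a ^ 2) ^ 2
            + Cconj a ^ 2 / (z ^ 2 - Cconj a ^ 2) ^ 2))%C.

Definition psi1 (t : R) (z : C) : C :=
  let a := expi t in
  (- Ci * (1 / (z ^ 2 - a ^ 2) - 1 / (z ^ 2 - Cconj a ^ 2)))%C.

Definition Rschwarz (t lambda : R) (z : C) : C :=
  (2 * psi0 t z - 2 * RtoC lambda * psi1 t z)%C.

Definition solves_ode_in_disk (t lambda : R) (y : C -> C) : Prop :=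
  forall z, unit_disk z ->
    C_differentiable y z /\ C_differentiable (C_derive y) z /\
    (C_derive (C_derive y) z + psi0 t z * y z
       = RtoC lambda * psi1 t z * y z)%C.

Definition solves_bvp (t lambda kappa : R) (u : R -> C) : Prop :=
  exists u1 u2 : R -> C,
    (forall x : R, 0 <= x <= 1 ->
       is_derive (K := R_AbsRing) (V := C_R_NormedModule) u x (u1 x) /\
       is_derive (K := R_AbsRing) (V := C_R_NormedModule) u1 x (u2 x) /\
       (u2 x + psi0 t (RtoC x) * u x
          = RtoC lambda * psi1 t (RtoC x) * u x)%C) /\
    u 0 = RtoC 1 /\ u1 0 = RtoC 0 /\
    (u 1%R ^ 2 - 2 * u 1%R * u1 1%R)%C = RtoC kappa.

(* Main.v *)
Require Import Defs.
From Stdlib Require Import Reals Lra Lia.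
From Coquelicot Require Import Coquelicot.

Local Open Scope R_scope.

(** Write [q] for [psi0 - lambda psi1], so that [y'' = - q y] while the Schwarzian
    derivative of [f] is [2 q].  A function with Schwarzian [2 q] has a derivative
    of the form [1 / u^2] with [u] a solution of [u'' = - q u], and the
    normalizations at 0 make [u = y].  Concretely, on each radius of the disk
    [y f'' + 2 y' f'] satisfies a linear equation and starts at 0, so it vanishes,
    and [y^2 f'] keeps its initial value 1 ([schwarzian_linearization]).  Hence
    neither [f'] nor [y] has a zero, and integrating [f' = 1 / y^2] gives the
    formula for [f].

    Both identities extend to the point 1 by continuity.  They give
    [f'(1) = 1 / y(1)^2] and [f''(1) = -2 y'(1) / y(1)^3], hence
    [(f'(1) + f''(1)) / f'(1)^2 = y(1)^2 - 2 y(1) y'(1)].  All these numbers are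
    real, since [q] is real on the real axis and [y] has real initial values
    ([ode_solution_real]).

    There remains the geometric meaning of the left-hand side.  The curve
    [s |-> f(e^(is))] stays on the circle or line of the right edge for [s] near 0;
    differentiating the equation of that circle twice at [s = 0] yields the
    curvature up to sign, and the sign follows from the position of the real
    point [f(1)] on an arc that goes upwards from [Cconj A] to [A]
    ([curvature_of_right_edge]).

    The analytic input is that a sum of a complex power series is differentiable
    with analytic derivative ([C_pseries_derive]). *)

(** * Derivatives along a parametrization of a subset of the plane *)

(** [F] is continuous at [x] when distances in [T] are measured through
    [i : T -> C].  With [i] the identity of [C] this concerns functions of a
    complex variable, with [i := RtoC] curves in the plane; one calculus then
    serves for the analytic functions and for their restrictions to radii and
    arcs, and the chain rule links the two. *)
Definition rel_cont {T : Type} (i F : T -> C) (x : T) : Prop :=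
  forall eps, 0 < eps -> exists d, 0 < d /\
    forall w, Cmod (i w - i x)%C < d -> Cmod (F w - F x)%C < eps.

(** Caratheodory's form of the derivative: the difference quotient extends
    continuously to [x].  With it the product, quotient and chain rules are
    identities between difference quotients, and only the continuity rules
    need estimates. *)
Definition rel_deriv {T : Type} (i F : T -> C) (x : T) (l : C) : Prop :=
  exists phi : T -> C, phi x = l /\ rel_cont i phi x /\
    exists d, 0 < d /\ forall w, Cmod (i w - i x)%C < d ->
      (F w - F x = phi w * (i w - i x))%C.

Lemma rel_cont_const {T} (i : T -> C) (c : C) x : rel_cont i (fun _ => c) x.
Proof.
  intros eps He; exists 1; split; [lra|]. intros w _.
  replace (c - c)%C with (RtoC 0) by ring. rewrite Cmod_0; lra.
Qed.

Lemma rel_cont_base {T} (i : T -> C) x : rel_cont i i x.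
Proof. intros eps He; exists eps; split; auto. Qed.

Lemma rel_cont_plus {T} (i F G : T -> C) x :
  rel_cont i F x -> rel_cont i G x -> rel_cont i (fun w => F w + G w)%C x.
Proof.
  intros HF HG eps He.
  destruct (HF (eps / 2)) as [d1 [Hd1 H1]]; [lra|].
  destruct (HG (eps / 2)) as [d2 [Hd2 H2]]; [lra|].
  exists (Rmin d1 d2); split; [now apply Rmin_pos|]. intros w Hw.
  specialize (H1 w (Rlt_le_trans _ _ _ Hw (Rmin_l _ _))).
  specialize (H2 w (Rlt_le_trans _ _ _ Hw (Rmin_r _ _))).
  replace (F w + G w - (F x + G x))%C with ((F w - F x) + (G w - G x))%C by ring.
  generalize (Cmod_triangle (F w - F x) (G w - G x)); lra.
Qed.

Lemma rel_cont_mult {T} (i F G : T -> C) x :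
  rel_cont i F x -> rel_cont i G x -> rel_cont i (fun w => F w * G w)%C x.
Proof.
  intros HF HG eps He.
  set (K := Cmod (F x) + Cmod (G x) + 1).
  pose proof (Cmod_ge_0 (F x)). pose proof (Cmod_ge_0 (G x)).
  assert (HK : 1 <= K) by (unfold K; lra).
  set (e := Rmin 1 (eps / (2 * K))).
  assert (He' : 0 < e) by (apply Rmin_pos; [lra|]; apply Rdiv_lt_0_compat; lra).
  assert (He1 : e <= 1) by apply Rmin_l.
  assert (HeK : e * K <= eps / 2).
  { apply Rle_trans with (eps / (2 * K) * K).
    - apply Rmult_le_compat_r; [lra | apply Rmin_r].
    - right; field; lra. }
  destruct (HF e He') as [d1 [Hd1 H1]].
  destruct (HG e He') as [d2 [Hd2 H2]].
  exists (Rmin d1 d2); split; [now apply Rmin_pos|]. intros w Hw.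
  specialize (H1 w (Rlt_le_trans _ _ _ Hw (Rmin_l _ _))).
  specialize (H2 w (Rlt_le_trans _ _ _ Hw (Rmin_r _ _))).
  replace (F w * G w - F x * G x)%C
    with ((F w - F x) * (G w - G x) + (F x * (G w - G x) + (F w - F x) * G x))%C
    by ring.
  eapply Rle_lt_trans; [apply Cmod_triangle|].
  eapply Rle_lt_trans; [apply Rplus_le_compat_l, Cmod_triangle|].
  rewrite !Cmod_mult.
  pose proof (Cmod_ge_0 (F w - F x)). pose proof (Cmod_ge_0 (G w - G x)).
  assert (Cmod (F w - F x) * Cmod (G w - G x) <= e * 1) by (apply Rmult_le_compat; lra).
  assert (Cmod (F x) * Cmod (G w - G x) <= Cmod (F x) * e) by (apply Rmult_le_compat_l; lra).
  assert (Cmod (F w - F x) * Cmod (G x) <= e * Cmod (G x)) by (apply Rmult_le_compat_r; lra).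
  unfold K in HeK. nra.
Qed.

Lemma rel_cont_opp {T} (i F : T -> C) x : rel_cont i F x -> rel_cont i (fun w => - F w)%C x.
Proof.
  intros HF eps He. destruct (HF eps He) as [d [Hd H]]. exists d; split; [exact Hd|].
  intros w Hw. replace (- F w - - F x)%C with (- (F w - F x))%C by ring.
  rewrite Cmod_opp. auto.
Qed.

Lemma rel_cont_pow {T} (i F : T -> C) (n : nat) x :
  rel_cont i F x -> rel_cont i (fun w => F w ^ n)%C x.
Proof.
  intros HF. induction n as [|n IH]; simpl; [apply rel_cont_const|].
  now apply rel_cont_mult.
Qed.

Lemma rel_cont_away {T} (i F : T -> C) x : F x <> RtoC 0 -> rel_cont i F x ->
  exists d, 0 < d /\ forall w, Cmod (i w - i x)%C < d ->
    Cmod (F x) / 2 < Cmod (F w) /\ F w <> RtoC 0.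
Proof.
  intros H0 HF. pose proof (proj1 (Cmod_gt_0 _) H0) as Hp.
  destruct (HF (Cmod (F x) / 2)) as [d [Hd H]]; [lra|].
  exists d; split; [exact Hd|]. intros w Hw. specialize (H w Hw).
  assert (Cmod (F x) / 2 < Cmod (F w)).
  { generalize (Cmod_triangle (F w) (- (F w - F x))%C).
    replace (F w + - (F w - F x))%C with (F x) by ring.
    rewrite Cmod_opp. lra. }
  split; [assumption|]. apply Cmod_gt_0. lra.
Qed.

Lemma rel_cont_inv {T} (i F : T -> C) x : F x <> RtoC 0 ->
  rel_cont i F x -> rel_cont i (fun w => / F w)%C x.
Proof.
  intros H0 HF eps He. pose proof (proj1 (Cmod_gt_0 _) H0) as Hp.
  destruct (rel_cont_away i F x H0 HF) as [d1 [Hd1 H1]].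
  set (m := Cmod (F x)) in *.
  destruct (HF (eps * (m * m / 2))) as [d2 [Hd2 H2]].
  { apply Rmult_lt_0_compat; [lra|]. nra. }
  exists (Rmin d1 d2); split; [now apply Rmin_pos|]. intros w Hw.
  destruct (H1 w (Rlt_le_trans _ _ _ Hw (Rmin_l _ _))) as [Hm Hn].
  specialize (H2 w (Rlt_le_trans _ _ _ Hw (Rmin_r _ _))).
  replace (/ F w - / F x)%C with (- (F w - F x) * / (F w * F x))%C
    by (field; split; assumption).
  rewrite Cmod_mult, Cmod_opp, Cmod_inv by now apply Cmult_neq_0.
  rewrite Cmod_mult. fold m.
  assert (0 < Cmod (F w) * m) by nra.
  apply (Rmult_lt_reg_r (Cmod (F w) * m)); [assumption|].
  rewrite Rmult_assoc, Rinv_l by lra. rewrite Rmult_1_r.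
  eapply Rlt_trans; [exact H2|]. apply Rmult_lt_compat_l; [exact He|]. nra.
Qed.

Lemma rel_cont_comp {T} (i g : T -> C) (F : C -> C) x :
  rel_cont (fun z => z) F (g x) -> rel_cont i g x -> rel_cont i (fun w => F (g w)) x.
Proof.
  intros HF Hg eps He. destruct (HF eps He) as [d [Hd H]].
  destruct (Hg d Hd) as [d' [Hd' H']]. exists d'; split; auto.
Qed.

Lemma rel_cont_conj {T} (i F : T -> C) x :
  rel_cont i F x -> rel_cont i (fun w => Cconj (F w)) x.
Proof.
  intros HF eps He. destruct (HF eps He) as [d [Hd H]]. exists d; split; [exact Hd|].
  intros w Hw. rewrite <- Cminus_conj, Cmod_conj. auto.
Qed.

Lemma rel_deriv_cont {T} (i F : T -> C) x l : rel_deriv i F x l -> rel_cont i F x.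
Proof.
  intros [phi [_ [Hc [d [Hd H]]]]] eps He.
  assert (Hm : rel_cont i (fun w => phi w * (i w + - i x))%C x).
  { apply rel_cont_mult; [exact Hc|].
    apply rel_cont_plus; [apply rel_cont_base | apply rel_cont_const]. }
  destruct (Hm eps He) as [d' [Hd' H']].
  exists (Rmin d d'); split; [now apply Rmin_pos|]. intros w Hw.
  rewrite (H w) by exact (Rlt_le_trans _ _ _ Hw (Rmin_l _ _)).
  specialize (H' w (Rlt_le_trans _ _ _ Hw (Rmin_r _ _))). simpl in H'.
  replace (phi w * (i w - i x))%C
    with (phi w * (i w + - i x) - phi x * (i x + - i x))%C by ring.
  exact H'.
Qed.

Lemma rel_deriv_const {T} (i : T -> C) (c : C) x : rel_deriv i (fun _ => c) x (RtoC 0).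
Proof.
  exists (fun _ => RtoC 0); split; [reflexivity|]; split; [apply rel_cont_const|].
  exists 1; split; [lra|]. intros; ring.
Qed.

Lemma rel_deriv_base {T} (i : T -> C) x : rel_deriv i i x (RtoC 1).
Proof.
  exists (fun _ => RtoC 1); split; [reflexivity|]; split; [apply rel_cont_const|].
  exists 1; split; [lra|]. intros; ring.
Qed.

Lemma rel_deriv_plus {T} (i F G : T -> C) x l m :
  rel_deriv i F x l -> rel_deriv i G x m ->
  rel_deriv i (fun w => F w + G w)%C x (l + m)%C.
Proof.
  intros [p [<- [Hp [d [Hd H]]]]] [q [<- [Hq [d' [Hd' H']]]]].
  exists (fun w => p w + q w)%C; split; [reflexivity|]; split; [now apply rel_cont_plus|].
  exists (Rmin d d'); split; [now apply Rmin_pos|]. intros w Hw.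
  specialize (H w (Rlt_le_trans _ _ _ Hw (Rmin_l _ _))).
  specialize (H' w (Rlt_le_trans _ _ _ Hw (Rmin_r _ _))).
  replace (F w + G w - (F x + G x))%C with ((F w - F x) + (G w - G x))%C by ring.
  rewrite H, H'. ring.
Qed.

Lemma rel_deriv_mult {T} (i F G : T -> C) x l m :
  rel_deriv i F x l -> rel_deriv i G x m ->
  rel_deriv i (fun w => F w * G w)%C x (l * G x + F x * m)%C.
Proof.
  intros HF HG. pose proof (rel_deriv_cont _ _ _ _ HG) as HGc.
  destruct HF as [p [<- [Hp [d [Hd H]]]]], HG as [q [<- [Hq [d' [Hd' H']]]]].
  exists (fun w => p w * G w + F x * q w)%C; split; [reflexivity|]; split.
  { apply rel_cont_plus; apply rel_cont_mult; auto using rel_cont_const. }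
  exists (Rmin d d'); split; [now apply Rmin_pos|]. intros w Hw.
  specialize (H w (Rlt_le_trans _ _ _ Hw (Rmin_l _ _))).
  specialize (H' w (Rlt_le_trans _ _ _ Hw (Rmin_r _ _))).
  replace (F w * G w - F x * G x)%C with ((F w - F x) * G w + F x * (G w - G x))%C by ring.
  rewrite H, H'. ring.
Qed.

Lemma rel_deriv_inv {T} (i F : T -> C) x l : F x <> RtoC 0 ->
  rel_deriv i F x l -> rel_deriv i (fun w => / F w)%C x (- l / (F x * F x))%C.
Proof.
  intros H0 HF. pose proof (rel_deriv_cont _ _ _ _ HF) as HFc.
  destruct (rel_cont_away i F x H0 HFc) as [d1 [Hd1 H1]].
  destruct HF as [p [<- [Hp [d [Hd H]]]]].
  exists (fun w => - (1) * p w * / (F w * F x))%C; split; [field; exact H0|]; split.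
  { apply rel_cont_mult; [apply rel_cont_mult; auto using rel_cont_const|].
    apply (rel_cont_inv i (fun w => F w * F x)%C); [now apply Cmult_neq_0|].
    apply rel_cont_mult; auto using rel_cont_const. }
  exists (Rmin d d1); split; [now apply Rmin_pos|]. intros w Hw.
  specialize (H w (Rlt_le_trans _ _ _ Hw (Rmin_l _ _))).
  destruct (H1 w (Rlt_le_trans _ _ _ Hw (Rmin_r _ _))) as [_ Hn].
  replace (/ F w - / F x)%C with (- (1) * (F w - F x) * / (F w * F x))%C
    by (field; split; assumption).
  rewrite H. ring.
Qed.

Lemma rel_deriv_comp {T} (i g : T -> C) (F : C -> C) x l m :
  rel_deriv (fun z => z) F (g x) l -> rel_deriv i g x m ->
  rel_deriv i (fun w => F (g w)) x (l * m)%C.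
Proof.
  intros HF Hg. pose proof (rel_deriv_cont _ _ _ _ Hg) as Hc.
  destruct HF as [p [<- [Hp [d [Hd H]]]]], Hg as [q [<- [Hq [d' [Hd' H']]]]].
  exists (fun w => p (g w) * q w)%C; split; [reflexivity|]; split.
  { apply rel_cont_mult; [|exact Hq]. now apply rel_cont_comp. }
  destruct (Hc d Hd) as [d1 [Hd1 H1]].
  exists (Rmin d1 d'); split; [now apply Rmin_pos|]. intros w Hw.
  rewrite (H (g w)) by (apply H1; exact (Rlt_le_trans _ _ _ Hw (Rmin_l _ _))).
  rewrite (H' w) by exact (Rlt_le_trans _ _ _ Hw (Rmin_r _ _)). ring.
Qed.

Lemma rel_deriv_ext_loc {T} (i F G : T -> C) x l r : 0 < r ->
  (forall w, Cmod (i w - i x)%C < r -> F w = G w) ->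
  rel_deriv i F x l -> rel_deriv i G x l.
Proof.
  intros Hr He [p [<- [Hp [d [Hd H]]]]].
  exists p; split; [reflexivity|]; split; [exact Hp|].
  exists (Rmin d r); split; [now apply Rmin_pos|]. intros w Hw.
  rewrite <- (He w) by exact (Rlt_le_trans _ _ _ Hw (Rmin_r _ _)).
  rewrite <- (He x).
  - apply H. exact (Rlt_le_trans _ _ _ Hw (Rmin_l _ _)).
  - replace (i x - i x)%C with (RtoC 0) by ring. now rewrite Cmod_0.
Qed.

Lemma rel_deriv_eq {T} (i F : T -> C) x l m :
  rel_deriv i F x l -> l = m -> rel_deriv i F x m.
Proof. now intros H <-. Qed.

Lemma rel_deriv_small_o {T} (i F : T -> C) x l :
  rel_deriv i F x l <->
  forall eps, 0 < eps -> exists d, 0 < d /\ forall w, Cmod (i w - i x)%C < d ->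
    Cmod (F w - F x - l * (i w - i x))%C <= eps * Cmod (i w - i x)%C.
Proof.
  split.
  - intros [p [<- [Hp [d [Hd H]]]]] eps He. destruct (Hp eps He) as [d' [Hd' H']].
    exists (Rmin d d'); split; [now apply Rmin_pos|]. intros w Hw.
    rewrite H by exact (Rlt_le_trans _ _ _ Hw (Rmin_l _ _)).
    replace (p w * (i w - i x) - p x * (i w - i x))%C
      with ((p w - p x) * (i w - i x))%C by ring.
    rewrite Cmod_mult. apply Rmult_le_compat_r; [apply Cmod_ge_0|].
    left; apply H'. exact (Rlt_le_trans _ _ _ Hw (Rmin_r _ _)).
  - intros H.
    set (p := fun w => if Ceq_dec (i w - i x) (RtoC 0) then l
                       else ((F w - F x) / (i w - i x))%C).
    assert (Hpx : p x = l).
    { unfold p. destruct (Ceq_dec (i x - i x) (RtoC 0)) as [_|n]; [reflexivity|].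
      destruct n; ring. }
    exists p; split; [exact Hpx|]; split.
    + intros eps He. destruct (H (eps / 2)) as [d [Hd Hd']]; [lra|].
      exists d; split; [exact Hd|]. intros w Hw. specialize (Hd' w Hw). rewrite Hpx.
      unfold p. destruct (Ceq_dec (i w - i x) (RtoC 0)) as [_|n].
      * replace (l - l)%C with (RtoC 0) by ring. now rewrite Cmod_0.
      * replace ((F w - F x) / (i w - i x) - l)%C
          with ((F w - F x - l * (i w - i x)) / (i w - i x))%C by (field; exact n).
        rewrite Cmod_div by exact n. pose proof (proj1 (Cmod_gt_0 _) n) as Hn.
        apply (Rmult_lt_reg_r (Cmod (i w - i x))); [exact Hn|].
        unfold Rdiv. rewrite Rmult_assoc, Rinv_l by lra. nra.
    + destruct (H 1) as [d [Hd Hd']]; [lra|].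
      exists d; split; [exact Hd|]. intros w Hw. unfold p.
      destruct (Ceq_dec (i w - i x) (RtoC 0)) as [E|n].
      * specialize (Hd' w Hw). rewrite E in *. rewrite Cmod_0 in Hd'.
        assert (Cmod (F w - F x - l * 0)%C = 0) as Z
          by (generalize (Cmod_ge_0 (F w - F x - l * 0)%C); lra).
        apply Cmod_eq_0 in Z. replace (F w - F x)%C with (F w - F x - l * 0)%C by ring.
        rewrite Z. ring.
      * field. exact n.
Qed.

Lemma C_is_derive_rel (f : C -> C) z l :
  is_derive (K := C_AbsRing) (V := C_NormedModule) f z l
  <-> rel_deriv (fun w => w) f z l.
Proof.
  rewrite rel_deriv_small_o. split.
  - intros [_ H] eps He.
    specialize (H z (fun P HP => HP) (mkposreal eps He)).
    destruct H as [d Hd]. exists d; split; [apply cond_pos|]. intros w Hw.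
    rewrite (Cmult_comm l). exact (Hd w Hw).
  - intros H. split; [apply is_linear_scal_l|]. intros x Hx.
    apply (@is_filter_lim_locally_unique C_AbsRing (AbsRing_NormedModule C_AbsRing)) in Hx.
    subst x. intros eps. destruct (H eps (cond_pos eps)) as [d [Hd Hw]].
    exists (mkposreal d Hd). intros w Hww. specialize (Hw w Hww).
    rewrite (Cmult_comm l) in Hw. exact Hw.
Qed.

Lemma norm_C_R (z : C) : @norm R_AbsRing C_R_NormedModule z = Cmod z.
Proof.
  unfold norm; simpl. unfold prod_norm, Cmod; simpl. unfold norm; simpl. unfold abs; simpl.
  f_equal. rewrite !Rmult_1_r, <- !Rabs_mult.
  rewrite !Rabs_pos_eq; [reflexivity | apply Rle_0_sqr | apply Rle_0_sqr].
Qed.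

Lemma R_is_derive_rel (f : R -> C) x l :
  is_derive (K := R_AbsRing) (V := C_R_NormedModule) f x l
  <-> rel_deriv RtoC f x l.
Proof.
  rewrite rel_deriv_small_o.
  assert (E : forall w, (RtoC w - RtoC x)%C = RtoC (w - x)) by (intro; now rewrite RtoC_minus).
  assert (N : forall w, Cmod (f w - f x - l * (RtoC w - RtoC x))%C =
    @norm R_AbsRing C_R_NormedModule (minus (minus (f w) (f x)) (scal (minus w x) l))).
  { intro w. rewrite norm_C_R, E, scal_R_Cmult, (Cmult_comm l). reflexivity. }
  split.
  - intros [_ H] eps He.
    specialize (H x (fun P HP => HP) (mkposreal eps He)).
    destruct H as [d Hd]. exists d; split; [apply cond_pos|]. intros w Hw.
    rewrite N. rewrite E, Cmod_R in *. exact (Hd w Hw).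
  - intros H. split; [apply is_linear_scal_l|]. intros y Hy.
    apply (@is_filter_lim_locally_unique R_AbsRing (AbsRing_NormedModule R_AbsRing)) in Hy.
    subst y. intros eps. destruct (H eps (cond_pos eps)) as [d [Hd Hw]].
    exists (mkposreal d Hd). intros w Hww. specialize (Hw w).
    rewrite N in Hw. rewrite E, Cmod_R in Hw. exact (Hw Hww).
Qed.

(** * Analytic functions of a complex variable *)

Lemma C_derive_rel (f : C -> C) z l : rel_deriv (fun w => w) f z l -> C_derive f z = l.
Proof. intro H. apply is_C_derive_unique, C_is_derive_rel, H. Qed.

(** The remainders [D_n = k^n - h^n - n h^(n-1) (k-h)] satisfy
    [D_(n+1) = k D_n + n h^(n-1) (k-h)^2], whence the bound by induction. *)
Lemma taylor2_pow (k h : C) (R : R) (n : nat) : Cmod k <= R -> Cmod h <= R ->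
  Cmod (k ^ S (S n) - h ^ S (S n) - RtoC (INR (S (S n))) * h ^ S n * (k - h))%C
  <= INR (S n) * INR (S (S n)) * R ^ n * Cmod (k - h)%C ^ 2.
Proof.
  intros Hk Hh. pose proof (Cmod_ge_0 k). pose proof (Cmod_ge_0 h).
  pose proof (Cmod_ge_0 (k - h)).
  induction n as [|n IH].
  - replace (_ - _ - _)%C with ((k - h) * (k - h))%C
      by (simpl; rewrite RtoC_plus; ring).
    rewrite Cmod_mult. simpl. nra.
  - set (D := (k ^ S (S n) - h ^ S (S n) - RtoC (INR (S (S n))) * h ^ S n * (k - h))%C) in *.
    assert (E : (k ^ S (S (S n)) - h ^ S (S (S n))
                 - RtoC (INR (S (S (S n)))) * h ^ S (S n) * (k - h))%C
      = (k * D + RtoC (INR (S (S n))) * h ^ S n * ((k - h) * (k - h)))%C).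
    { unfold D. rewrite (S_INR (S (S n))), RtoC_plus. simpl Cpow. ring. }
    rewrite E. eapply Rle_trans; [apply Cmod_triangle|]. rewrite !Cmod_mult.
    rewrite Cmod_R, Rabs_pos_eq by apply pos_INR.
    rewrite Cmod_pow.
    set (q := Cmod (k - h)) in *.
    pose proof (pos_INR n).
    assert (Hp : Cmod h ^ S n <= R ^ S n) by (apply pow_incr; lra).
    assert (0 <= R ^ n) by (apply pow_le; lra).
    assert (T1 : Cmod k * Cmod D <= R * (INR (S n) * INR (S (S n)) * R ^ n * q ^ 2))
      by (apply Rmult_le_compat; auto using Cmod_ge_0).
    assert (T2 : INR (S (S n)) * Cmod h ^ S n * (q * q) <= INR (S (S n)) * R ^ S n * (q * q)).
    { apply Rmult_le_compat_r; [nra|]. apply Rmult_le_compat_l; [apply pos_INR|exact Hp]. }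
    eapply Rle_trans; [apply Rplus_le_compat; [exact T1|exact T2]|].
    rewrite !S_INR. simpl pow.
    assert (0 <= R * R ^ n * (q * q)) by (apply Rmult_le_pos; nra).
    assert (0 <= INR n * (R * R ^ n * (q * q))) by (apply Rmult_le_pos; lra).
    nra.
Qed.

Lemma Cpow_pow_n (z : C) n : @pow_n C_AbsRing z n = (z ^ n)%C.
Proof. induction n as [|n IH]; [reflexivity|]. simpl. rewrite IH. reflexivity. Qed.

Lemma C_is_series_norm_le (c : nat -> C) (b : nat -> R) (l : C) :
  @is_series C_AbsRing C_NormedModule c l ->
  (forall n, Cmod (c n) <= b n) -> ex_series b -> Cmod l <= Series b.
Proof.
  intros Hc Hb Hs.
  assert (Hlim : is_lim_seq (fun n => Cmod (sum_n c n)) (Cmod l)).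
  { unfold is_lim_seq. simpl.
    change (filterlim (fun n => @norm C_AbsRing C_NormedModule (@sum_n C_NormedModule c n)) eventually
      (locally (@norm C_AbsRing C_NormedModule l))).
    eapply filterlim_comp; [exact Hc|]. apply filterlim_norm. }
  assert (Hlim' : is_lim_seq (sum_n b) (Series b)) by exact (Series_correct b Hs).
  refine (is_lim_seq_le _ (sum_n b) (Cmod l) (Series b) _ Hlim Hlim').
  intro n.
  eapply Rle_trans; [apply (@norm_sum_n_m C_AbsRing C_NormedModule)|].
  apply sum_n_m_le. exact Hb.
Qed.

Lemma C_is_series_tail (c : nat -> C) (l : C) : c 0%nat = RtoC 0 ->
  @is_series C_AbsRing C_NormedModule c l ->
  @is_series C_AbsRing C_NormedModule (fun n => c (S n)) l.
Proof.
  intros H0 H. apply is_series_incr_1. rewrite H0.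
  refine (eq_ind l (@is_series C_AbsRing C_NormedModule c) H _ _).
  symmetry. apply Cplus_0_r.
Qed.

(** The terms of a convergent series are bounded.  This hands the absolute
    convergence of complex power series over to the real theory of the radius
    of convergence, applied to the moduli of the coefficients. *)
Lemma C_pseries_radius (a : nat -> C) (rho : R) (l : C) : 0 <= rho ->
  @is_pseries C_AbsRing C_NormedModule a (RtoC rho) l ->
  Rbar_le rho (CV_radius (fun n => Cmod (a n))).
Proof.
  intros Hrho H.
  destruct (filterlim_bounded (K := C_AbsRing) (V := C_NormedModule) _
              (ex_intro _ l H)) as [M HM].
  apply (proj1 (CV_radius_bounded _)). exists (2 * M). intro n.
  replace (Cmod (a n) * rho ^ n) with (Cmod (a n * RtoC rho ^ n)%C)
    by now rewrite Cmod_mult, Cmod_pow, Cmod_R, (Rabs_pos_eq rho Hrho).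
  rewrite Rabs_pos_eq by apply Cmod_ge_0.
  set (u := fun k => @scal C_AbsRing C_NormedModule (@pow_n C_AbsRing (RtoC rho) k) (a k)) in *.
  assert (Hu : u n = (a n * RtoC rho ^ n)%C)
    by (unfold u; rewrite Cpow_pow_n; apply Cmult_comm).
  rewrite <- Hu.
  change (Cmod (u n)) with (@norm C_AbsRing C_NormedModule (u n)).
  pose proof (Rle_trans _ _ _ (norm_ge_0 _) (HM 0%nat)).
  destruct n as [|n].
  - specialize (HM 0%nat). rewrite sum_O in HM. lra.
  - pose proof (HM n) as M1. pose proof (HM (S n)) as M2. rewrite sum_Sn in M2.
    set (A := sum_n u n) in *.
    change (Cmod A <= M) in M1. change (Cmod (A + u (S n))%C <= M) in M2.
    change (Cmod (u (S n)) <= 2 * M).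
    replace (u (S n)) with (A + u (S n) + - A)%C by ring.
    generalize (Cmod_triangle (A + u (S n)) (- A)). rewrite Cmod_opp. lra.
Qed.

Definition C_PS_derive (a : nat -> C) (n : nat) : C := (RtoC (INR (S n)) * a (S n))%C.

(** By [taylor2_pow], the difference between [f v - f w] and the termwise linear
    part is at most [|v - w|^2] times the sum of [(n+1)(n+2) |a_(n+2)| R^n],
    which converges because differentiating a real power series twice does not
    change its radius of convergence. *)
Lemma C_pseries_derive (a : nat -> C) (z : C) (r R : R) (f : C -> C) : 0 < R < r ->
  (forall w, Cmod (w - z)%C < r ->
     @is_pseries C_AbsRing C_NormedModule a (w - z)%C (f w)) ->
  forall w, Cmod (w - z)%C < R ->
    rel_deriv (fun w => w) f w (C_derive f w) /\
    @is_pseries C_AbsRing C_NormedModule (C_PS_derive a) (w - z)%C (C_derive f w).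
Proof.
  intros [HR0 HR] Hf w Hw.
  assert (Hrad : Rbar_lt (Rabs R) (CV_radius (fun n => Cmod (a n)))).
  { apply Rbar_lt_le_trans with ((R + r) / 2).
    - simpl. rewrite Rabs_pos_eq; lra.
    - apply (C_pseries_radius _ _ (f (z + RtoC ((R + r) / 2))%C)); [lra|].
      replace (RtoC ((R + r) / 2)) with (z + RtoC ((R + r) / 2) - z)%C at 1 by ring.
      apply Hf. replace (z + RtoC ((R + r) / 2) - z)%C with (RtoC ((R + r) / 2)) by ring.
      rewrite Cmod_R, Rabs_pos_eq; lra. }
  assert (Hs1 : ex_series (fun n => INR (S n) * Cmod (a (S n)) * R ^ n)).
  { eapply ex_series_ext; [|apply (CV_disk_inside (PS_derive (fun n => Cmod (a n))) R)].
    - intro n. unfold PS_derive. apply Rabs_pos_eq.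
      repeat apply Rmult_le_pos; auto using pos_INR, Cmod_ge_0. apply pow_le; lra.
    - now rewrite CV_radius_derive. }
  assert (Hs2 : ex_series (fun n => INR (S n) * (INR (S (S n)) * Cmod (a (S (S n)))) * R ^ n)).
  { eapply ex_series_ext;
      [|apply (CV_disk_inside (PS_derive (PS_derive (fun n => Cmod (a n)))) R)].
    - intro n. unfold PS_derive. apply Rabs_pos_eq.
      repeat apply Rmult_le_pos; auto using pos_INR, Cmod_ge_0. apply pow_le; lra.
    - now rewrite !CV_radius_derive. }
  assert (Hd : exists l, @is_pseries C_AbsRing C_NormedModule (C_PS_derive a) (w - z)%C l).
  { change (@ex_series C_AbsRing C_CompleteNormedModule
      (fun n => @scal C_AbsRing C_NormedModule (@pow_n C_AbsRing (w - z)%C n) (C_PS_derive a n))).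
    refine (ex_series_le _ _ _ Hs1). intro n.
    change (Cmod (@pow_n C_AbsRing (w - z)%C n * C_PS_derive a n)%C
            <= INR (S n) * Cmod (a (S n)) * R ^ n).
    rewrite Cpow_pow_n. unfold C_PS_derive.
    rewrite !Cmod_mult, Cmod_pow, Cmod_R, Rabs_pos_eq by apply pos_INR.
    rewrite Rmult_comm. apply Rmult_le_compat_l.
    - apply Rmult_le_pos; auto using pos_INR, Cmod_ge_0.
    - apply pow_incr. split; [apply Cmod_ge_0|lra]. }
  destruct Hd as [l Hl].
  enough (Hrel : rel_deriv (fun w => w) f w l).
  { rewrite (C_derive_rel _ _ _ Hrel). auto. }
  apply rel_deriv_small_o. intros eps He.
  set (K := Series (fun n => INR (S n) * (INR (S (S n)) * Cmod (a (S (S n)))) * R ^ n)).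
  assert (HK : forall v, Cmod (v - z)%C < R ->
     Cmod (f v - f w - l * (v - w))%C <= K * Cmod (v - w)%C ^ 2).
  { intros v Hv.
    set (k := (v - z)%C). set (h := (w - z)%C).
    set (c := fun n => (a (S (S n)) * (k ^ S (S n) - h ^ S (S n)
                 - RtoC (INR (S (S n))) * h ^ S n * (k - h)))%C).
    (* The terms of index 0 and 1 of the remainder series vanish, so two shifts
       of the index turn it into the series of [c]. *)
    assert (Hc : @is_series C_AbsRing C_NormedModule c (f v - f w - l * (v - w))%C).
    { pose proof (Hf v ltac:(lra)) as S1. pose proof (Hf w ltac:(lra)) as S2.
      unfold is_pseries in S1, S2, Hl. fold k in S1. fold h in S2, Hl.
      pose proof (is_series_minus _ _ _ _ S1 S2) as S3.
      apply C_is_series_tail in S3; [|simpl; unfold plus, opp, scal; simpl; unfold mult; simpl; unfold one; simpl; ring].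
      pose proof (is_series_minus _ _ _ _ S3 (is_series_scal (k - h)%C _ _ Hl)) as S4.
      apply C_is_series_tail in S4.
      - refine (is_series_ext _ c _ _ _).
        2:{ replace (f v - f w - l * (v - w))%C with (f v - f w - (k - h) * l)%C
              by (unfold k, h; ring). exact S4. }
        intro n. cbv beta. rewrite !Cpow_pow_n. unfold c, C_PS_derive.
        change (k ^ S (S n) * a (S (S n)) - h ^ S (S n) * a (S (S n))
                - (k - h) * (h ^ S n * (INR (S (S n)) * a (S (S n)))) =
                a (S (S n)) * (k ^ S (S n) - h ^ S (S n) - INR (S (S n)) * h ^ S n * (k - h)))%C.
        ring.
      - rewrite !Cpow_pow_n. unfold C_PS_derive.
        change (k ^ 1 * a 1%nat - h ^ 1 * a 1%nat - (k - h) * (h ^ 0 * (1 * a 1%nat)) = 0)%C.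
        simpl. ring. }
    replace (v - w)%C with (k - h)%C in * by (unfold k, h; ring).
    unfold K. rewrite <- Series_scal_r.
    apply (C_is_series_norm_le c); [exact Hc| |now apply ex_series_scal_r].
    intro n. unfold c. rewrite Cmod_mult.
    apply Rle_trans with (Cmod (a (S (S n))) *
      (INR (S n) * INR (S (S n)) * R ^ n * Cmod (k - h)%C ^ 2)).
    - apply Rmult_le_compat_l; [apply Cmod_ge_0|]. apply taylor2_pow; unfold k, h; lra.
    - right; ring. }
  set (K' := Rabs K + 1). assert (HK' : 0 < K') by (unfold K'; generalize (Rabs_pos K); lra).
  exists (Rmin (R - Cmod (w - z)%C) (eps / K')).
  split; [apply Rmin_pos; [lra|now apply Rdiv_lt_0_compat]|]. intros v Hv.
  pose proof (Rlt_le_trans _ _ _ Hv (Rmin_l _ _)) as V1.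
  pose proof (Rlt_le_trans _ _ _ Hv (Rmin_r _ _)) as V2.
  eapply Rle_trans; [apply HK|].
  { replace (v - z)%C with ((v - w) + (w - z))%C by ring.
    eapply Rle_lt_trans; [apply Cmod_triangle|]. lra. }
  set (q := Cmod (v - w)%C) in *. assert (0 <= q) by apply Cmod_ge_0.
  simpl pow. rewrite Rmult_1_r, <- Rmult_assoc. apply Rmult_le_compat_r; [assumption|].
  assert (q * K' <= eps).
  { apply Rle_trans with (eps / K' * K'); [|right; field; lra].
    apply Rmult_le_compat_r; lra. }
  apply Rle_trans with (q * K'); [|assumption]. rewrite Rmult_comm.
  apply Rmult_le_compat_l; [assumption|]. unfold K'. generalize (Rle_abs K); lra.
Qed.

Lemma analytic_near_derivable (f : C -> C) (z : C) : analytic_at f z ->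
  exists r, 0 < r /\ forall w, Cmod (w - z)%C < r ->
    rel_deriv (fun w => w) f w (C_derive f w).
Proof.
  intros [a [r [Hr H]]]. exists (r / 2); split; [lra|]. intros w Hw.
  exact (proj1 (C_pseries_derive a z r (r / 2) f ltac:(lra) H w Hw)).
Qed.

Lemma analytic_derivable (f : C -> C) (z : C) : analytic_at f z ->
  rel_deriv (fun w => w) f z (C_derive f z).
Proof.
  intros H. destruct (analytic_near_derivable f z H) as [r [Hr H']]. apply H'.
  replace (z - z)%C with (RtoC 0) by ring. now rewrite Cmod_0.
Qed.

Lemma analytic_C_derive (f : C -> C) (z : C) : analytic_at f z ->
  analytic_at (C_derive f) z.
Proof.
  intros [a [r [Hr H]]]. exists (C_PS_derive a), (r / 2); split; [lra|]. intros w Hw.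
  exact (proj2 (C_pseries_derive a z r (r / 2) f ltac:(lra) H w Hw)).
Qed.

(** * The linear equation behind the Schwarzian derivative *)

Lemma Cmod_RtoC_minus (a b : R) : Cmod (RtoC a - RtoC b)%C = Rabs (a - b).
Proof. now rewrite <- RtoC_minus, Cmod_R. Qed.

Lemma rel_cont_left_limit (G : R -> C) (a s : R) (c : C) : a < s ->
  rel_cont RtoC G s -> (forall x, a <= x < s -> G x = c) -> G s = c.
Proof.
  intros Has HG Hc. apply Ceq_minus.
  destruct (Ceq_dec (G s - c)%C (RtoC 0)) as [E|E]; [exact E|exfalso].
  apply Cmod_gt_0 in E. destruct (HG _ E) as [d [Hd H]].
  set (x := Rmax a (s - d / 2)).
  assert (a <= x) by apply Rmax_l. assert (s - d / 2 <= x) by apply Rmax_r.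
  assert (x < s) by (unfold x; apply Rmax_lub_lt; lra).
  specialize (H x). rewrite Cmod_RtoC_minus, (Hc x) in H by lra.
  rewrite Rabs_left in H by lra. specialize (H ltac:(lra)).
  rewrite <- Cmod_opp in H. replace (- (c - G s))%C with (G s - c)%C in H by ring. lra.
Qed.

Lemma rel_deriv_zero_constant (F : R -> C) (a b : R) : a <= b ->
  (forall s, a <= s <= b -> rel_deriv RtoC F s (RtoC 0)) -> F b = F a.
Proof.
  intros [Hab| ->] H; [|reflexivity]. symmetry.
  apply (eq_is_derive (V := C_R_NormedModule) F a b); [|exact Hab].
  intros s Hs. apply R_is_derive_rel. exact (H s Hs).
Qed.

(** The topological step that rules out a first zero of [f'] on a radius. *)
Lemma interval_induction (K : R -> Prop) (b : R) : 0 <= b -> K 0 ->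
  (forall s, 0 <= s <= b -> K s ->
     exists d, 0 < d /\ forall x, s <= x < s + d -> x <= b -> K x) ->
  (forall s, 0 < s <= b -> (forall x, 0 <= x < s -> K x) -> K s) ->
  forall s, 0 <= s <= b -> K s.
Proof.
  intros Hb K0 Kopen Kclosed.
  set (E := fun s => 0 <= s <= b /\ forall x, 0 <= x <= s -> K x).
  assert (E0 : E 0).
  { split; [lra|]. intros x Hx. now replace x with 0 by lra. }
  destruct (completeness E) as [m [Hub Hlub]].
  { exists b. intros x [Hx _]. lra. }
  { exists 0. exact E0. }
  assert (Hm0 : 0 <= m) by (apply Hub; exact E0).
  assert (Hmb : m <= b) by (apply Hlub; intros x [Hx _]; lra).
  assert (Hlt : forall x, 0 <= x < m -> K x).
  { intros x Hx. destruct (Classical_Prop.classic (K x)) as [k|k]; [exact k|exfalso].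
    assert (m <= x); [|lra]. apply Hlub. intros y [_ Hy].
    destruct (Rle_dec y x) as [l|l]; [exact l|]. exfalso; apply k, Hy. lra. }
  assert (Hm : K m).
  { destruct (Req_dec m 0) as [->|n]; [exact K0|]. apply Kclosed; [lra|exact Hlt]. }
  assert (Hall : forall x, 0 <= x <= m -> K x).
  { intros x Hx. destruct (Req_dec x m) as [->|n]; [exact Hm|]. apply Hlt; lra. }
  destruct (Kopen m ltac:(lra) Hm) as [d [Hd H]].
  assert (b <= m).
  { destruct (Rle_dec b m) as [l|l]; [exact l|exfalso].
    set (x := Rmin b (m + d / 2)).
    assert (x <= b) by apply Rmin_l. assert (x <= m + d / 2) by apply Rmin_r.
    assert (m < x) by (unfold x; apply Rmin_glb_lt; lra).
    assert (x <= m); [|lra]. apply Hub. split; [lra|]. intros v Hv.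
    destruct (Rle_dec v m); [apply Hall; lra|apply H; lra]. }
  intros s Hs. apply Hall; lra.
Qed.

(** Along the radius [s |-> z s], think of [P, Q, T] as [f', f'', f'''] and of
    [Y, Y1] as [y, y'] with [y'' = - q y].  The hypothesis on [T] says that the
    Schwarzian of [f] is [2 q] wherever [f'] does not vanish.

    Put [V = y f'' + 2 y' f'].  While [f'] does not vanish, the Schwarzian
    equation gives [V' = (3/2) (f''/f') V], so [V^2 / f'^3] is constant, and [V],
    which starts at 0, vanishes.  But [(y^2 f')' = y V], so [y^2 f' = 1].  This
    identity passes to the limit at a hypothetical first zero of [f'], where it
    is absurd; so [f'] has no zero, and neither does [y]. *)
Lemma schwarzian_linearization (z : C) (P Q T q Y Y1 : R -> C) :
  (forall s, 0 <= s <= 1 ->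
     rel_deriv RtoC P s (z * Q s)%C /\ rel_deriv RtoC Q s (z * T s)%C /\
     rel_deriv RtoC Y s (z * Y1 s)%C /\ rel_deriv RtoC Y1 s (z * (- q s * Y s))%C) ->
  (forall s, 0 <= s <= 1 -> P s <> RtoC 0 ->
     (2 * T s * P s = 3 * Q s * Q s + 4 * q s * P s * P s)%C) ->
  P 0 = RtoC 1 -> Q 0 = RtoC 0 -> Y 0 = RtoC 1 -> Y1 0 = RtoC 0 ->
  forall s, 0 <= s <= 1 ->
    (Y s * Y s * P s = 1)%C /\ (Y s * Q s + 2 * Y1 s * P s = 0)%C.
Proof.
  intros HD HS HP0 HQ0 HY0 HY10.
  set (V := fun s => (Y s * Q s + 2 * (Y1 s * P s))%C).
  assert (HV : forall b, 0 <= b <= 1 -> (forall x, 0 <= x <= b -> P x <> RtoC 0) ->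
     forall s, 0 <= s <= b -> V s = RtoC 0).
  { intros b Hb Hnz s Hs.
    set (H := fun s => (V s * V s * / (P s * (P s * P s)))%C).
    assert (E : H s = H 0).
    { apply rel_deriv_zero_constant; [lra|]. intros x Hx.
      destruct (HD x) as [DP [DQ [DY DY1]]]; [lra|].
      pose proof (Hnz x ltac:(lra)) as Nx.
      assert (HT : T x = ((3 * Q x * Q x + 4 * q x * P x * P x) / (2 * P x))%C).
      { rewrite <- (HS x ltac:(lra) Nx). field. exact Nx. }
      assert (DV : rel_deriv RtoC V x (3 / 2 * z * (Q x / P x) * V x)%C).
      { eapply rel_deriv_eq.
        - apply rel_deriv_plus; [exact (rel_deriv_mult _ _ _ _ _ _ DY DQ)|].
          exact (rel_deriv_mult _ _ _ _ _ _ (rel_deriv_const _ (RtoC 2) x)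
                   (rel_deriv_mult _ _ _ _ _ _ DY1 DP)).
        - unfold V. rewrite HT. field. exact Nx. }
      assert (N3 : (P x * (P x * P x))%C <> RtoC 0) by (repeat apply Cmult_neq_0; exact Nx).
      eapply rel_deriv_eq.
      - exact (rel_deriv_mult _ _ _ _ _ _ (rel_deriv_mult _ _ _ _ _ _ DV DV)
          (rel_deriv_inv RtoC (fun s => (P s * (P s * P s))%C) x _ N3
            (rel_deriv_mult _ _ _ _ _ _ DP (rel_deriv_mult _ _ _ _ _ _ DP DP)))).
      - cbv beta. field. exact Nx. }
    assert (HV0 : V 0 = RtoC 0) by (unfold V; rewrite HQ0, HY10; ring).
    unfold H in E. rewrite HV0 in E.
    pose proof (Hnz s ltac:(lra)) as Ns.
    destruct (Ceq_dec (V s) (RtoC 0)) as [e|n]; [exact e|exfalso].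
    assert (E2 : (V s * V s * / (P s * (P s * P s)))%C = RtoC 0).
    { rewrite E. ring. }
    revert E2. repeat apply Cmult_neq_0; auto.
    intro Z. apply C1_nz. rewrite <- (Cinv_r (P s * (P s * P s))), Z by
      (repeat apply Cmult_neq_0; exact Ns). ring. }
  assert (HG : forall b, 0 <= b <= 1 -> (forall x, 0 <= x <= b -> P x <> RtoC 0) ->
     (Y b * Y b * P b = 1)%C).
  { intros b Hb Hnz.
    replace (RtoC 1) with (Y 0 * Y 0 * P 0)%C by (rewrite HY0, HP0; ring).
    apply (rel_deriv_zero_constant (fun s => Y s * Y s * P s)%C); [lra|]. intros x Hx.
    destruct (HD x) as [DP [DQ [DY DY1]]]; [lra|].
    pose proof (HV b Hb Hnz x Hx) as Vx. unfold V in Vx.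
    eapply rel_deriv_eq;
      [exact (rel_deriv_mult _ _ _ _ _ _ (rel_deriv_mult _ _ _ _ _ _ DY DY) DP)|].
    transitivity (z * Y x * (Y x * Q x + 2 * (Y1 x * P x)))%C; [ring|]. rewrite Vx. ring. }
  assert (Hnz : forall s, 0 <= s <= 1 -> P s <> RtoC 0).
  { apply interval_induction; [lra| | |].
    - rewrite HP0. exact C1_nz.
    - intros s Hs N. destruct (HD s Hs) as [DP _].
      destruct (rel_cont_away _ _ _ N (rel_deriv_cont _ _ _ _ DP)) as [d [Hd H]].
      exists d; split; [exact Hd|]. intros x Hx _. apply H.
      rewrite Cmod_RtoC_minus, Rabs_pos_eq; lra.
    - intros s Hs N Z. destruct (HD s ltac:(lra)) as [DP [_ [DY _]]].
      apply C1_nz. rewrite <- (rel_cont_left_limit (fun s => Y s * Y s * P s)%C 0 s (RtoC 1)).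
      + rewrite Z. ring.
      + lra.
      + apply rel_cont_mult; [apply rel_cont_mult|]; eapply rel_deriv_cont; eassumption.
      + intros x Hx. apply HG; [lra|]. intros v Hv. apply N. lra. }
  intros s Hs. split.
  - apply HG; [exact Hs|]. intros x Hx. apply Hnz. lra.
  - rewrite <- (HV s Hs) with (s := s); [|intros x Hx; apply Hnz; lra|lra].
    unfold V. ring.
Qed.

(** * Solutions in the disk and their values on the real radius *)

Lemma Cmod_scaled_in_disk (z : C) (s : R) : 0 <= s <= 1 -> unit_disk z -> unit_disk (z * RtoC s)%C.
Proof.
  unfold unit_disk. intros Hs Hz. rewrite Cmod_mult, Cmod_R, Rabs_pos_eq by lra.
  pose proof (Cmod_ge_0 z). nra.
Qed.

Lemma RtoC_in_disk (x : R) : 0 <= x < 1 -> unit_disk (RtoC x).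
Proof. intros Hx. unfold unit_disk. rewrite Cmod_R, Rabs_pos_eq; lra. Qed.

Lemma rel_deriv_radius (F : C -> C) (z l : C) (s : R) :
  rel_deriv (fun w => w) F (z * RtoC s)%C l ->
  rel_deriv RtoC (fun s => F (z * RtoC s)%C) s (z * l)%C.
Proof.
  intros H. eapply rel_deriv_eq.
  - eapply (rel_deriv_comp RtoC (fun s => z * RtoC s)%C F s l _ H).
    exact (rel_deriv_mult _ _ _ _ _ _ (rel_deriv_const _ z s) (rel_deriv_base _ s)).
  - cbv beta. ring.
Qed.

Lemma rel_deriv_real (F : C -> C) (x : R) (l : C) :
  rel_deriv (fun w => w) F (RtoC x) l -> rel_deriv RtoC (fun s => F (RtoC s)) x l.
Proof.
  intros H. eapply rel_deriv_eq.
  - eapply (rel_deriv_comp RtoC RtoC F x l _ H), rel_deriv_base.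
  - ring.
Qed.

Lemma rel_deriv_conj (F : R -> C) (x : R) (l : C) :
  rel_deriv RtoC F x l -> rel_deriv RtoC (fun s => Cconj (F s)) x (Cconj l).
Proof.
  intros [p [<- [Hp [d [Hd H]]]]].
  exists (fun s => Cconj (p s)); split; [reflexivity|]; split; [now apply rel_cont_conj|].
  exists d; split; [exact Hd|]. intros w Hw.
  rewrite <- Cminus_conj, H, Cmult_conj by exact Hw. f_equal.
  rewrite <- RtoC_minus. unfold Cconj, RtoC; simpl. f_equal; ring.
Qed.

Lemma schwarzian_value (f : C -> C) (z : C) : analytic_at f z -> C_derive f z <> RtoC 0 ->
  let P := C_derive f z in let Q := C_derive (C_derive f) z in
  let T := C_derive (C_derive (C_derive f)) z in
  (2 * T * P = 3 * Q * Q + 2 * schwarzian f z * P * P)%C.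
Proof.
  intros Hf HP P Q T.
  pose proof (analytic_C_derive _ _ Hf) as Hf1.
  pose proof (analytic_C_derive _ _ Hf1) as Hf2.
  pose proof (rel_deriv_mult _ _ _ _ _ _ (analytic_derivable _ _ Hf2)
    (rel_deriv_inv _ _ _ _ HP (analytic_derivable _ _ Hf1))) as DN.
  apply C_derive_rel in DN. unfold schwarzian.
  change (fun w : C => (C_derive (C_derive f) w / C_derive f w)%C)
    with (fun w : C => (C_derive (C_derive f) w * / C_derive f w)%C).
  rewrite DN. fold P Q T. simpl Cpow. field. exact HP.
Qed.

Lemma schwarzian_ode_in_disk (f y q : C -> C) :
  (forall z, unit_disk z -> analytic_at f z) ->
  (forall z, unit_disk z -> schwarzian f z = (2 * q z)%C) ->
  (forall z, unit_disk z -> rel_deriv (fun w => w) y z (C_derive y z) /\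
     rel_deriv (fun w => w) (C_derive y) z (- q z * y z)%C) ->
  C_derive f (RtoC 0) = RtoC 1 -> C_derive (C_derive f) (RtoC 0) = RtoC 0 ->
  y (RtoC 0) = RtoC 1 -> C_derive y (RtoC 0) = RtoC 0 ->
  forall z, unit_disk z ->
    (y z * y z * C_derive f z = 1)%C /\
    (y z * C_derive (C_derive f) z + 2 * C_derive y z * C_derive f z = 0)%C.
Proof.
  intros Hf HS Hy F1 F2 Y0 Y1 z Hz.
  assert (E0 : (z * RtoC 0)%C = RtoC 0) by ring.
  rewrite <- (Cmult_1_r z).
  apply (schwarzian_linearization z
    (fun s => C_derive f (z * RtoC s)%C) (fun s => C_derive (C_derive f) (z * RtoC s)%C)
    (fun s => C_derive (C_derive (C_derive f)) (z * RtoC s)%C) (fun s => q (z * RtoC s)%C)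
    (fun s => y (z * RtoC s)%C) (fun s => C_derive y (z * RtoC s)%C));
    rewrite ?E0; auto; try lra.
  - intros s Hs. pose proof (Cmod_scaled_in_disk z s Hs Hz) as D.
    pose proof (analytic_C_derive _ _ (Hf _ D)) as A1.
    pose proof (analytic_C_derive _ _ A1) as A2.
    destruct (Hy _ D) as [D1 D2].
    repeat split; apply rel_deriv_radius; auto using analytic_derivable.
  - intros s Hs HP. pose proof (Cmod_scaled_in_disk z s Hs Hz) as D.
    rewrite (schwarzian_value f _ (Hf _ D) HP), (HS _ D). ring.
Qed.

(** Where [q] is real, the conjugate of a solution is a solution.  The initial
    values being real, the Wronskian of [y] and its conjugate vanishes, so the
    quotient of the two, defined because [y] has no zero, keeps its initial
    value 1.  The vanishing Wronskian then makes [y'] real too. *)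
Lemma ode_solution_real (y q : C -> C) :
  (forall x : R, 0 <= x < 1 -> Cconj (q (RtoC x)) = q (RtoC x)) ->
  (forall z, unit_disk z -> rel_deriv (fun w => w) y z (C_derive y z) /\
     rel_deriv (fun w => w) (C_derive y) z (- q z * y z)%C) ->
  y (RtoC 0) = RtoC 1 -> C_derive y (RtoC 0) = RtoC 0 ->
  (forall z, unit_disk z -> y z <> RtoC 0) ->
  forall x : R, 0 <= x < 1 ->
    Cconj (y (RtoC x)) = y (RtoC x) /\ Cconj (C_derive y (RtoC x)) = C_derive y (RtoC x).
Proof.
  intros Hq Hy Y0 Y1 Hnz.
  assert (Hc : forall r : R, Cconj (RtoC r) = RtoC r)
    by (intro r; unfold Cconj, RtoC; simpl; f_equal; ring).
  assert (HD : forall x, 0 <= x < 1 ->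
     rel_deriv RtoC (fun s => y (RtoC s)) x (C_derive y (RtoC x)) /\
     rel_deriv RtoC (fun s => C_derive y (RtoC s)) x (- q (RtoC x) * y (RtoC x))%C /\
     rel_deriv RtoC (fun s => Cconj (y (RtoC s))) x (Cconj (C_derive y (RtoC x))) /\
     rel_deriv RtoC (fun s => Cconj (C_derive y (RtoC s))) x
       (- q (RtoC x) * Cconj (y (RtoC x)))%C).
  { intros x Hx. destruct (Hy _ (RtoC_in_disk x Hx)) as [D1 D2].
    apply rel_deriv_real in D1, D2.
    repeat split; auto using rel_deriv_conj.
    eapply rel_deriv_eq; [exact (rel_deriv_conj _ _ _ D2)|].
    now rewrite Cmult_conj, Copp_conj, Hq. }
  assert (HW : forall x, 0 <= x < 1 ->
    (y (RtoC x) * Cconj (C_derive y (RtoC x)) + - (1) * (C_derive y (RtoC x) * Cconj (y (RtoC x))) = 0)%C).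
  { intros x Hx.
    transitivity (y (RtoC 0) * Cconj (C_derive y (RtoC 0))
       + - (1) * (C_derive y (RtoC 0) * Cconj (y (RtoC 0))))%C.
    2:{ rewrite Y1, Hc. ring. }
    apply (rel_deriv_zero_constant (fun x => y (RtoC x) * Cconj (C_derive y (RtoC x))
       + - (1) * (C_derive y (RtoC x) * Cconj (y (RtoC x))))%C); [lra|].
    intros s Hs. destruct (HD s ltac:(lra)) as [D1 [D2 [D3 D4]]].
    eapply rel_deriv_eq.
    - apply rel_deriv_plus; [exact (rel_deriv_mult _ _ _ _ _ _ D1 D4)|].
      exact (rel_deriv_mult _ _ _ _ _ _ (rel_deriv_const _ (- (1))%C s)
        (rel_deriv_mult _ _ _ _ _ _ D2 D3)).
    - cbv beta. ring. }
  assert (HY : forall x, 0 <= x < 1 -> Cconj (y (RtoC x)) = y (RtoC x)).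
  { intros x Hx. pose proof (Hnz _ (RtoC_in_disk x Hx)) as Nx.
    assert (E : (Cconj (y (RtoC x)) * / y (RtoC x))%C = (Cconj (y (RtoC 0)) * / y (RtoC 0))%C).
    { apply (rel_deriv_zero_constant (fun x => Cconj (y (RtoC x)) * / y (RtoC x))%C); [lra|].
      intros s Hs. destruct (HD s ltac:(lra)) as [D1 [_ [D3 _]]].
      pose proof (Hnz _ (RtoC_in_disk s ltac:(lra))) as Ns.
      eapply rel_deriv_eq.
      - exact (rel_deriv_mult _ _ _ _ _ _ D3 (rel_deriv_inv RtoC (fun s => y (RtoC s)) _ _ Ns D1)).
      - cbv beta.
        transitivity ((y (RtoC s) * Cconj (C_derive y (RtoC s))
          + - (1) * (C_derive y (RtoC s) * Cconj (y (RtoC s)))) / (y (RtoC s) * y (RtoC s)))%C.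
        { field. exact Ns. }
        rewrite HW by lra. field. exact Ns. }
    rewrite Y0, Hc in E.
    transitivity (Cconj (y (RtoC x)) * / y (RtoC x) * y (RtoC x))%C; [field; exact Nx|].
    rewrite E. field. }
  intros x Hx. split; [now apply HY|].
  pose proof (Hnz _ (RtoC_in_disk x Hx)) as Nx.
  pose proof (HW x Hx) as W. rewrite (HY x Hx) in W.
  apply Ceq_minus. destruct (Ceq_dec (Cconj (C_derive y (RtoC x)) - C_derive y (RtoC x))%C (RtoC 0))
    as [e|n]; [exact e|exfalso].
  apply (Cmult_neq_0 _ _ Nx n). rewrite <- W. ring.
Qed.

(** * Integrals, arcs and second-order contact with a circle *)

Lemma Rabs_Im_le_Cmod (z : C) : Rabs (Im z) <= Cmod z.
Proof.
  eapply Rle_trans; [|apply Rmax_Cmod]. apply Rmax_r.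
Qed.

Lemma Rabs_Re_le_Cmod (z : C) : Rabs (Re z) <= Cmod z.
Proof.
  eapply Rle_trans; [|apply Rmax_Cmod]. apply Rmax_l.
Qed.

Lemma R_is_derive_small_o (h : R -> R) (x l : R) :
  is_derive h x l <->
  forall eps, 0 < eps -> exists d, 0 < d /\ forall w, Rabs (w - x) < d ->
    Rabs (h w - h x - (w - x) * l) <= eps * Rabs (w - x).
Proof.
  split.
  - intros [_ H] eps He.
    specialize (H x (fun P HP => HP) (mkposreal eps He)).
    destruct H as [d Hd]. exists d; split; [apply cond_pos|]. intros w Hw.
    exact (Hd w Hw).
  - intros H. split; [apply is_linear_scal_l|]. intros y Hy.
    apply (@is_filter_lim_locally_unique R_AbsRing (AbsRing_NormedModule R_AbsRing)) in Hy.
    subst y. intros eps. destruct (H eps (cond_pos eps)) as [d [Hd Hw]].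
    exists (mkposreal d Hd). intros w Hww. exact (Hw w Hww).
Qed.

Lemma rel_deriv_RtoC (h : R -> R) (x l : R) : is_derive h x l ->
  rel_deriv RtoC (fun s => RtoC (h s)) x (RtoC l).
Proof.
  rewrite R_is_derive_small_o, rel_deriv_small_o. intros H eps He.
  destruct (H eps He) as [d [Hd H']]. exists d; split; [exact Hd|]. intros w.
  specialize (H' w). rewrite (Rmult_comm (w - x) l) in H'.
  rewrite <- !RtoC_minus, <- RtoC_mult, <- RtoC_minus, !Cmod_R. exact H'.
Qed.

Lemma rel_deriv_is_derive_Re (F : R -> C) (x : R) (l : C) :
  rel_deriv RtoC F x l -> is_derive (fun s => Re (F s)) x (Re l).
Proof.
  rewrite R_is_derive_small_o, rel_deriv_small_o. intros H eps He.
  destruct (H eps He) as [d [Hd H']]. exists d; split; [exact Hd|]. intros w Hw.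
  specialize (H' w). rewrite Cmod_RtoC_minus in H'.
  eapply Rle_trans; [|exact (H' Hw)].
  eapply Rle_trans; [|apply Rabs_Re_le_Cmod]. right; f_equal.
  unfold Re; simpl. ring.
Qed.

Lemma rel_deriv_is_derive_Im (F : R -> C) (x : R) (l : C) :
  rel_deriv RtoC F x l -> is_derive (fun s => Im (F s)) x (Im l).
Proof.
  rewrite R_is_derive_small_o, rel_deriv_small_o. intros H eps He.
  destruct (H eps He) as [d [Hd H']]. exists d; split; [exact Hd|]. intros w Hw.
  specialize (H' w). rewrite Cmod_RtoC_minus in H'.
  eapply Rle_trans; [|exact (H' Hw)].
  eapply Rle_trans; [|apply Rabs_Im_le_Cmod]. right; f_equal.
  unfold Im; simpl. ring.
Qed.

Lemma rel_cont_continuous (F : R -> C) (h : C -> R) (x : R) :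
  (forall z w, Rabs (h z - h w) <= Cmod (z - w)%C) ->
  rel_cont RtoC F x -> continuous (fun s => h (F s)) x.
Proof.
  intros Hh HF. apply filterlim_locally. intros eps.
  destruct (HF eps (cond_pos eps)) as [d [Hd H]].
  exists (mkposreal d Hd). intros w Hw.
  change (Rabs (h (F w) - h (F x)) < eps).
  eapply Rle_lt_trans; [apply Hh|]. apply H. rewrite Cmod_RtoC_minus. exact Hw.
Qed.

Lemma C_is_RInt_derive (F F' : R -> C) (a b : R) : a <= b ->
  (forall x, a <= x <= b -> rel_deriv RtoC F x (F' x)) ->
  (forall x, a <= x <= b -> rel_cont RtoC F' x) ->
  is_RInt (V := C_R_NormedModule) F' a b (F b - F a)%C.
Proof.
  intros Hab HF HF'.
  change (F b - F a)%C with (Re (F b) - Re (F a), Im (F b) - Im (F a)).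
  apply (is_RInt_fct_extend_pair (U := R_NormedModule) (V := R_NormedModule)).
  - apply (is_RInt_derive (V := R_CompleteNormedModule) (fun s => Re (F s)) (fun s => Re (F' s)));
      rewrite Rmin_left, Rmax_right by exact Hab; intros x Hx.
    + apply rel_deriv_is_derive_Re, HF, Hx.
    + apply rel_cont_continuous; [|apply HF', Hx]. intros z w. exact (Rabs_Re_le_Cmod (z - w)).
  - apply (is_RInt_derive (V := R_CompleteNormedModule) (fun s => Im (F s)) (fun s => Im (F' s)));
      rewrite Rmin_left, Rmax_right by exact Hab; intros x Hx.
    + apply rel_deriv_is_derive_Im, HF, Hx.
    + apply rel_cont_continuous; [|apply HF', Hx]. intros z w. exact (Rabs_Im_le_Cmod (z - w)).
Qed.

Lemma rel_deriv_expi (x : R) : rel_deriv RtoC expi x (Ci * expi x)%C.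
Proof.
  apply (rel_deriv_ext_loc RtoC (fun s => RtoC (cos s) + Ci * RtoC (sin s))%C expi x _ 1); [lra| |].
  - intros w _. unfold expi, RtoC, Ci, Cplus, Cmult; simpl. f_equal; ring.
  - assert (Dc : is_derive cos x (- sin x)) by apply is_derive_cos.
    assert (Ds : is_derive sin x (cos x)) by apply is_derive_sin.
    eapply rel_deriv_eq.
    + apply rel_deriv_plus; [exact (rel_deriv_RtoC _ _ _ Dc)|].
      exact (rel_deriv_mult _ _ _ _ _ _ (rel_deriv_const _ Ci x) (rel_deriv_RtoC _ _ _ Ds)).
    + unfold expi, RtoC, Ci, Cplus, Cmult; simpl. f_equal; ring.
Qed.

Lemma rel_deriv_locally_constant (F : R -> C) (x d : R) (c l : C) : 0 < d ->
  (forall w, Rabs (w - x) < d -> F w = c) -> rel_deriv RtoC F x l -> l = RtoC 0.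
Proof.
  intros Hd Hc [p [<- [Hp [d' [Hd' H]]]]].
  destruct (Ceq_dec (p x) (RtoC 0)) as [e|n]; [exact e|exfalso].
  destruct (rel_cont_away _ _ _ n Hp) as [d2 [Hd2 H2]].
  set (r := Rmin d (Rmin d' d2)).
  assert (r <= d) by apply Rmin_l.
  assert (r <= d') by (eapply Rle_trans; [apply Rmin_r|apply Rmin_l]).
  assert (r <= d2) by (eapply Rle_trans; [apply Rmin_r|apply Rmin_r]).
  assert (0 < r) by (repeat apply Rmin_pos; assumption).
  assert (Hw : Rabs (x + r / 2 - x) < r) by (rewrite Rabs_pos_eq; lra).
  specialize (H (x + r / 2)). specialize (H2 (x + r / 2)). rewrite !Cmod_RtoC_minus in *.
  rewrite (Hc (x + r / 2)), (Hc x) in H by (rewrite ?Rminus_diag, ?Rabs_R0; lra).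
  specialize (H ltac:(lra)). destruct (H2 ltac:(lra)) as [_ N].
  apply (Cmult_neq_0 (p (x + r / 2)) (RtoC (x + r / 2) - RtoC x)); [exact N| |].
  - rewrite <- RtoC_minus. intro E. apply RtoC_inj in E. lra.
  - rewrite <- H. ring.
Qed.

(** The equation alpha |w|^2 + 2 Re (beta w) = m, with alpha real, is that of a
    circle (alpha nonzero) or of a line (alpha zero).  A curve that satisfies
    it satisfies its first and second derivatives as well; this treats arcs
    and segments together. *)
Lemma generalized_circle_second_order (g g1 : R -> C) (g2 : C) (d : R)
    (alpha beta m : C) : 0 < d ->
  (forall s, Rabs s < d -> rel_deriv RtoC g s (g1 s)) ->
  rel_deriv RtoC g1 0 g2 ->
  (forall s, Rabs s < d ->
     (alpha * (g s * Cconj (g s)) + (beta * g s + Cconj beta * Cconj (g s)) = m)%C) ->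
  (alpha * (g1 0%R * Cconj (g 0%R) + g 0%R * Cconj (g1 0%R))
     + (beta * g1 0%R + Cconj beta * Cconj (g1 0%R)) = 0)%C /\
  (alpha * (g2 * Cconj (g 0%R) + 2 * (g1 0%R * Cconj (g1 0%R)) + g 0%R * Cconj g2)
     + (beta * g2 + Cconj beta * Cconj g2) = 0)%C.
Proof.
  intros Hd Dg Dg1 Hm.
  set (F1 := fun s => (alpha * (g1 s * Cconj (g s) + g s * Cconj (g1 s))
     + (beta * g1 s + Cconj beta * Cconj (g1 s)))%C).
  assert (H1 : forall s, Rabs s < d -> F1 s = RtoC 0).
  { intros s Hs. pose proof (Dg s Hs) as D. pose proof (rel_deriv_conj _ _ _ D) as Dc.
    apply (rel_deriv_locally_constant
      (fun s => (alpha * (g s * Cconj (g s)) + (beta * g s + Cconj beta * Cconj (g s)))%C)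
      s (d - Rabs s) m); [lra| |].
    - intros w Hw. apply Hm. generalize (Rabs_triang (w - s) s).
      replace (w - s + s) with w by ring. lra.
    - eapply rel_deriv_eq.
      + apply rel_deriv_plus.
        * exact (rel_deriv_mult _ _ _ _ _ _ (rel_deriv_const _ alpha s)
            (rel_deriv_mult _ _ _ _ _ _ D Dc)).
        * apply rel_deriv_plus.
          -- exact (rel_deriv_mult _ _ _ _ _ _ (rel_deriv_const _ beta s) D).
          -- exact (rel_deriv_mult _ _ _ _ _ _ (rel_deriv_const _ (Cconj beta) s) Dc).
      + unfold F1. cbv beta. ring. }
  assert (H00 : Rabs 0 < d) by now rewrite Rabs_R0.
  split; [exact (H1 0 H00)|].
  pose proof (Dg 0 H00) as D. pose proof (rel_deriv_conj _ _ _ D) as Dc.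
  pose proof (rel_deriv_conj _ _ _ Dg1) as Dc1.
  apply (rel_deriv_locally_constant F1 0 d (RtoC 0)); [exact Hd| |].
  - intros w Hw. apply H1. now rewrite Rminus_0_r in Hw.
  - eapply rel_deriv_eq.
    + apply rel_deriv_plus.
      * exact (rel_deriv_mult _ _ _ _ _ _ (rel_deriv_const _ alpha 0)
          (rel_deriv_plus _ _ _ _ _ _ (rel_deriv_mult _ _ _ _ _ _ Dg1 Dc)
             (rel_deriv_mult _ _ _ _ _ _ D Dc1))).
      * apply rel_deriv_plus.
        -- exact (rel_deriv_mult _ _ _ _ _ _ (rel_deriv_const _ beta 0) Dg1).
        -- exact (rel_deriv_mult _ _ _ _ _ _ (rel_deriv_const _ (Cconj beta) 0) Dc1).
    + cbv beta. ring.
Qed.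

(** The curve is the image under [f] of the unit circle at angle [s]; its first
    and second derivatives at [s = 0] are [i f'(1)] and [- (f'(1) + f''(1))],
    which is where the combination in the curvature formula comes from. *)
Lemma analytic_on_circle_at_1 (f : C -> C) (d0 : R) (alpha beta m : C) : 0 < d0 ->
  analytic_at f (RtoC 1) ->
  (forall s, Rabs s < d0 -> let w := f (expi s) in
     (alpha * (w * Cconj w) + (beta * w + Cconj beta * Cconj w) = m)%C) ->
  let w := f (RtoC 1) in
  let g1 := (Ci * C_derive f (RtoC 1))%C in
  let g2 := (- (C_derive f (RtoC 1) + C_derive (C_derive f) (RtoC 1)))%C in
  (alpha * (g1 * Cconj w + w * Cconj g1) + (beta * g1 + Cconj beta * Cconj g1) = 0)%C /\
  (alpha * (g2 * Cconj w + 2 * (g1 * Cconj g1) + w * Cconj g2)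
     + (beta * g2 + Cconj beta * Cconj g2) = 0)%C.
Proof.
  intros Hd0 Hf Hm w g1 g2.
  destruct (analytic_near_derivable f _ Hf) as [r [Hr Df]].
  pose proof (analytic_derivable _ _ (analytic_C_derive _ _ Hf)) as Df1.
  assert (E0 : expi 0 = RtoC 1) by (unfold expi; rewrite cos_0, sin_0; reflexivity).
  destruct (rel_deriv_cont _ _ _ _ (rel_deriv_expi 0) r Hr) as [d1 [Hd1 H1]].
  assert (Hg1 : (C_derive f (expi 0) * (Ci * expi 0))%C = g1).
  { rewrite E0. unfold g1. ring. }
  assert (Hw : f (expi 0) = w) by now rewrite E0.
  rewrite <- Hg1, <- Hw.
  apply (generalized_circle_second_order (fun s => f (expi s))
    (fun s => C_derive f (expi s) * (Ci * expi s))%C g2 (Rmin d0 d1) alpha beta m).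
  - now apply Rmin_pos.
  - intros s Hs. apply (rel_deriv_comp RtoC expi f s); [|apply rel_deriv_expi].
    apply Df. rewrite <- E0. apply H1. rewrite Cmod_RtoC_minus, Rminus_0_r.
    exact (Rlt_le_trans _ _ _ Hs (Rmin_r _ _)).
  - rewrite <- E0 in Df1. eapply rel_deriv_eq.
    + exact (rel_deriv_mult _ _ _ _ _ _
        (rel_deriv_comp RtoC expi _ 0 _ _ Df1 (rel_deriv_expi 0))
        (rel_deriv_mult _ _ _ _ _ _ (rel_deriv_const _ Ci 0) (rel_deriv_expi 0))).
    + cbv beta. rewrite E0. unfold g2.
      assert (I2 : (Ci * Ci)%C = (- (1))%C) by (unfold Ci, Cmult, RtoC, Copp; simpl; f_equal; ring).
      transitivity (Ci * Ci * (C_derive f (RtoC 1) + C_derive (C_derive f) (RtoC 1)))%C; [ring|].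
      rewrite I2. ring.
  - intros s Hs. apply Hm. exact (Rlt_le_trans _ _ _ Hs (Rmin_l _ _)).
Qed.

(** The arc from angle [phi] to [phi + delta] joins two points that are mirror
    images in the horizontal diameter, the second one being the upper one.  If
    it turns left it crosses that diameter on the right of the centre,
    otherwise on the left.  Writing [phi = u - a] and [phi + delta = u + b], the
    symmetry forces [a = b = delta / 2] because [|delta| < 2 PI]. *)
Lemma arc_crossing_real_axis (phi delta s : R) : 0 <= s <= 1 ->
  0 < Rabs delta < 2 * PI ->
  cos (phi + delta) = cos phi -> sin phi < sin (phi + delta) ->
  sin (phi + s * delta) = 0 -> cos (phi + s * delta) = sign delta.
Proof.
  intros Hs Hdelta Hc Hsin Hu.
  set (u := phi + s * delta) in *.
  set (a := s * delta) in *. set (b := delta - a).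
  replace phi with (u - a) in Hc, Hsin by (unfold u; ring).
  replace (u - a + delta) with (u + b) in Hc, Hsin by (unfold b; ring).
  rewrite cos_plus, cos_minus, Hu in Hc. rewrite sin_plus, sin_minus, Hu in Hsin.
  pose proof (sin2_cos2 u) as Hu2. rewrite Hu in Hu2. unfold Rsqr in Hu2.
  assert (Hcos : cos u = 1 \/ cos u = -1).
  { assert ((cos u - 1) * (cos u + 1) = 0) by lra.
    destruct (Rmult_integral _ _ H); [left|right]; lra. }
  assert (Hab : cos b = cos a) by (destruct Hcos as [E|E]; rewrite E in Hc; lra).
  set (h := delta / 2). set (k := (1 - 2 * s) * h).
  replace a with (h - k) in * by (unfold a, k, h; field).
  replace b with (h + k) in * by (unfold b, a, k, h; field).
  rewrite cos_plus, cos_minus in Hab. rewrite sin_plus, sin_minus in Hsin.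
  assert (Hh : - PI < h < PI /\ h <> 0).
  { unfold h. destruct Hdelta as [D1 D2]. apply Rabs_def2 in D2.
    split; [lra|]. intro. assert (delta = 0) as -> by lra. rewrite Rabs_R0 in D1. lra. }
  assert (Hsign : 0 < delta /\ 0 < sin h \/ delta < 0 /\ sin h < 0).
  { destruct (Rlt_dec 0 h).
    - left; split; [unfold h in *; lra | apply sin_gt_0; lra].
    - right; split; [unfold h in *; lra | apply sin_lt_0_var; lra]. }
  assert (Hk : sin k = 0).
  { assert (sin h * sin k = 0) by lra.
    destruct (Rmult_integral _ _ H) as [E|E]; [exfalso; lra|exact E]. }
  assert (Hkb : - PI < k < PI) by (unfold k; nra).
  assert (k = 0).
  { destruct (Rtotal_order k 0) as [L|[E|G]]; [exfalso|exact E|exfalso].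
    - generalize (sin_lt_0_var k); lra.
    - generalize (sin_gt_0 k); lra. }
  rewrite H, cos_0, sin_0 in Hsin.
  destruct Hsign as [[D S]|[D S]].
  - rewrite (sign_eq_1 _ D). destruct Hcos as [E|E]; [exact E|]. rewrite E in Hsin. lra.
  - rewrite (sign_eq_m1 _ D). destruct Hcos as [E|E]; [|lra]. rewrite E in Hsin. lra.
Qed.

(** * The curvature of the right edge, and the boundary value problem *)

(** When the edge is an arc with centre [c] and radius [rho], differentiating
    [|f(e^(is)) - c|^2 = rho^2] at [s = 0] once shows that [f(1) - c] is a real
    number [X], and twice that [p^2 = (p + q) X].  The point [f(1)] lies on the
    edge, and [arc_crossing_real_axis] finds [X = rho * sign delta].  On a
    segment the real part of [f(e^(is))] is constant, and its second derivative
    gives [p + q = 0]. *)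
Lemma curvature_of_right_edge (edge0 : edge) (A : C) (f : C -> C) (t p q : R) :
  0 < t -> 0 < Im A -> edge_proper edge0 ->
  edge_point edge0 0 = Cconj A -> edge_point edge0 1 = A ->
  analytic_at f (RtoC 1) ->
  (forall theta, - t <= theta <= t -> on_edge edge0 (f (expi theta))) ->
  C_derive f (RtoC 1) = RtoC p -> C_derive (C_derive f) (RtoC 1) = RtoC q -> p <> 0 ->
  edge_curvature edge0 = (p + q) / p ^ 2.
Proof.
  intros Ht HA Hprop H0 H1 Hf Hon Hp Hq Hp0.
  assert (E0 : expi 0 = RtoC 1) by (unfold expi; rewrite cos_0, sin_0; reflexivity).
  destruct edge0 as [p0 q0|c rho phi delta]; simpl edge_curvature.
  - assert (Ep0 : p0 = Cconj A) by (rewrite <- H0; simpl; ring).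
    assert (Eq0 : q0 = A) by (rewrite <- H1; simpl; ring).
    (* A line: [w + Cconj w] is constant along the segment. *)
    destruct (analytic_on_circle_at_1 f t (RtoC 0) (RtoC 1) (A + Cconj A)%C Ht Hf) as [_ K].
    { intros s Hs w. apply Rabs_def2 in Hs.
      destruct (Hon s ltac:(lra)) as [v [_ Hv]]. unfold w. rewrite <- Hv. simpl.
      rewrite Ep0, Eq0. apply injective_projections; simpl; ring. }
    rewrite Hp, Hq in K. apply (f_equal fst) in K. simpl in K.
    assert (p + q = 0) as -> by lra. unfold Rdiv; ring.
  - destruct Hprop as [Hrho Hdelta].
    (* A circle: [|w - c|^2 = rho^2], expanded. *)
    destruct (analytic_on_circle_at_1 f t (RtoC 1) (- Cconj c)%C
      (RtoC (rho * rho) - c * Cconj c)%C Ht Hf) as [K1 K2].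
    { intros s Hs w. apply Rabs_def2 in Hs.
      destruct (Hon s ltac:(lra)) as [v [_ Hv]]. unfold w. rewrite <- Hv. simpl.
      pose proof (sin2_cos2 (phi + v * delta)) as Hsc. unfold Rsqr in Hsc.
      apply injective_projections; simpl; [|ring].
      transitivity (rho * rho * (sin (phi + v * delta) * sin (phi + v * delta)
        + cos (phi + v * delta) * cos (phi + v * delta)) - (fst c * fst c + snd c * snd c)).
      - ring.
      - rewrite Hsc. ring. }
    destruct (Hon 0 ltac:(lra)) as [v [Hv Ev]]. rewrite E0 in Ev.
    rewrite Hp, <- Ev in K1. rewrite Hp, Hq, <- Ev in K2.
    apply (f_equal fst) in K1, K2. simpl in K1, K2.
    apply (f_equal fst) in H0 as H0x. apply (f_equal snd) in H0 as H0y.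
    apply (f_equal fst) in H1 as H1x. apply (f_equal snd) in H1 as H1y.
    simpl in H0x, H0y, H1x, H1y. unfold Im in HA.
    rewrite Rmult_0_l, Rplus_0_r in H0x, H0y. rewrite Rmult_1_l in H1x, H1y.
    (* [K1] and [K2] now read [2 p rho sin u = 0] and
       [-2 (p + q) rho cos u + 2 p^2 = 0], where [u] is the angle of [f(1)]. *)
    assert (Hs : sin (phi + v * delta) = 0).
    { apply (Rmult_eq_reg_l (2 * p * rho)).
      - rewrite Rmult_0_r, <- K1. ring.
      - repeat apply Rmult_integral_contrapositive_currified; lra. }
    assert (Hc : cos (phi + v * delta) = sign delta).
    { apply (arc_crossing_real_axis phi delta v Hv Hdelta); [| |exact Hs].
      - apply (Rmult_eq_reg_l rho); lra.
      - apply (Rmult_lt_reg_l rho); lra. }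
    assert (Hpq : (p + q) * (rho * sign delta) = p ^ 2).
    { rewrite <- Hc. apply (Rmult_eq_reg_l (-2)); [|lra].
      apply Rminus_diag_uniq. rewrite <- K2. ring. }
    assert (Hsign : sign delta * sign delta = 1).
    { destruct (Rlt_dec 0 delta) as [D|D].
      - rewrite (sign_eq_1 _ D). ring.
      - rewrite sign_eq_m1; [ring|]. destruct (Req_dec delta 0) as [->|]; [|lra].
        rewrite Rabs_R0 in Hdelta. lra. }
    rewrite <- Hpq. assert (p + q <> 0).
    { intro Z. rewrite Z in Hpq. apply (pow_nonzero p 2 Hp0). lra. }
    assert (sign delta <> 0) by (intro Z; rewrite Z in Hsign; lra).
    transitivity (sign delta * sign delta / (rho * sign delta)); [field; lra|].
    rewrite Hsign. field. lra.
Qed.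

(** The squares of the poles have imaginary part [2 sin t cos t] or its
    opposite, which is not 0 for [0 < t < PI / 2]. *)
Lemma poles_off_real_axis (t x : R) : 0 < t < PI / 2 ->
  (RtoC x ^ 2 - expi t ^ 2)%C <> RtoC 0 /\ (RtoC x ^ 2 - Cconj (expi t) ^ 2)%C <> RtoC 0.
Proof.
  intros Ht. assert (0 < sin t) by (apply sin_gt_0; lra).
  assert (0 < cos t) by (apply cos_gt_0; lra).
  assert (0 < sin t * cos t) by nra.
  split; intro E; apply (f_equal snd) in E; simpl in E; lra.
Qed.

Definition ode_potential (t lambda : R) (z : C) : C := (psi0 t z - RtoC lambda * psi1 t z)%C.

Lemma ode_potential_real (t lambda x : R) : 0 < t < PI / 2 ->
  Cconj (ode_potential t lambda (RtoC x)) = ode_potential t lambda (RtoC x).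
Proof.
  intros Ht. destruct (poles_off_real_axis t x Ht) as [N1 N2].
  unfold ode_potential, psi0, psi1.
  assert (Hc : forall r : R, Cconj (RtoC r) = RtoC r)
    by (intro r; unfold Cconj, RtoC; simpl; f_equal; ring).
  assert (Hi : Cconj Ci = (- Ci)%C) by (unfold Cconj, Ci, Copp; simpl; f_equal; ring).
  assert (H34 : RtoC 4 <> RtoC 0) by (intro E; apply RtoC_inj in E; lra).
  repeat rewrite ?Cminus_conj, ?Cplus_conj, ?Cmult_conj, ?Copp_conj, ?Hi, ?Hc.
  rewrite !Cdiv_conj by (try apply Cpow_nz; assumption).
  repeat rewrite ?Cminus_conj, ?Cpow_conj, ?Cconj_conj, ?Hc.
  ring.
Qed.

Lemma ode_potential_continuous (t lambda x : R) : 0 < t < PI / 2 ->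
  rel_cont RtoC (fun s => ode_potential t lambda (RtoC s)) x.
Proof.
  intros Ht. destruct (poles_off_real_axis t x Ht) as [N1 N2].
  assert (Hx : rel_cont RtoC RtoC x) by apply rel_cont_base.
  assert (C1 : rel_cont RtoC (fun s => RtoC s ^ 2 - expi t ^ 2)%C x).
  { apply rel_cont_plus; [now apply rel_cont_pow|apply rel_cont_const]. }
  assert (C2 : rel_cont RtoC (fun s => RtoC s ^ 2 - Cconj (expi t) ^ 2)%C x).
  { apply rel_cont_plus; [now apply rel_cont_pow|apply rel_cont_const]. }
  pose proof (rel_cont_inv _ (fun s => RtoC s ^ 2 - expi t ^ 2)%C x N1 C1) as I1.
  pose proof (rel_cont_inv _ (fun s => RtoC s ^ 2 - Cconj (expi t) ^ 2)%C x N2 C2) as I2.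
  pose proof (rel_cont_inv _ (fun s => (RtoC s ^ 2 - expi t ^ 2) ^ 2)%C x
    (Cpow_nz _ 2 N1) (rel_cont_pow _ _ 2 _ C1)) as I3.
  pose proof (rel_cont_inv _ (fun s => (RtoC s ^ 2 - Cconj (expi t) ^ 2) ^ 2)%C x
    (Cpow_nz _ 2 N2) (rel_cont_pow _ _ 2 _ C2)) as I4.
  unfold ode_potential, psi0, psi1.
  apply rel_cont_plus; [apply rel_cont_mult; [apply rel_cont_const|]; apply rel_cont_plus;
    apply rel_cont_mult; auto using rel_cont_const|].
  apply rel_cont_opp. repeat (apply rel_cont_mult; [apply rel_cont_const|]).
  apply rel_cont_plus; [|apply rel_cont_opp];
    apply rel_cont_mult; auto using rel_cont_const.
Qed.

(* [f] and [y] are total functions: on the closed disk [f] denotes its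
   continuous boundary extension, and near [1] both denote their analytic
   extensions. *)
Theorem mainTheorem1 (t lambda : R) (A : C) (e : nat -> edge) (D : C -> Prop)
    (f y : C -> C)
    (ht : 0 < t < PI / 2)
    (hP : symmetric_circular_quadrilateral A e D)
    (hD0 : D (RtoC 0))
    (hf : conformal_from_disk f D)
    (hf_bdry : continuous_on closed_unit_disk f)
    (hfA : f (expi t) = A)
    (hf0 : f (RtoC 0) = RtoC 0)
    (hf1 : C_derive f (RtoC 0) = RtoC 1)
    (hf2 : C_derive (C_derive f) (RtoC 0) = RtoC 0)
    (hS : forall z, unit_disk z -> schwarzian f z = Rschwarz t lambda z)
    (hright : forall w, on_edge (right_edge e) w <->
                exists theta : R, - t <= theta <= t /\ f (expi theta) = w)
    (hf_ext : analytic_at f (RtoC 1))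
    (hy : solves_ode_in_disk t lambda y)
    (hy0 : y (RtoC 0) = RtoC 1)
    (hy1 : C_derive y (RtoC 0) = RtoC 0)
    (hy_ext : analytic_at y (RtoC 1)) :
  let kappa := edge_curvature (right_edge e) in
  (forall z, unit_disk z ->
     y z <> RtoC 0 /\
     is_segment_integral (fun w => / (y w) ^ 2)%C (RtoC 0) z (f z)) /\
  RtoC kappa = ((C_derive f (RtoC 1) + C_derive (C_derive f) (RtoC 1))
                  / (C_derive f (RtoC 1)) ^ 2)%C /\
  RtoC kappa = (y (RtoC 1) ^ 2 - 2 * y (RtoC 1) * C_derive y (RtoC 1))%C /\
  solves_bvp t lambda kappa (fun x : R => y (RtoC x)).
Proof.
  intros kappa.
  destruct hf as [hf _].
  set (q := ode_potential t lambda).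
  assert (Hy : forall z, unit_disk z ->
     rel_deriv (fun w => w) y z (C_derive y z) /\
     rel_deriv (fun w => w) (C_derive y) z (- q z * y z)%C).
  { intros z Hz. destruct (hy z Hz) as [D1 [D2 E]].
    pose proof (C_derive_correct _ _ z D1) as D1'.
    pose proof (C_derive_correct _ _ z D2) as D2'.
    split; [now apply C_is_derive_rel|].
    eapply rel_deriv_eq; [apply C_is_derive_rel; exact D2'|].
    unfold q, ode_potential.
    transitivity (C_derive (C_derive y) z + psi0 t z * y z - psi0 t z * y z)%C; [ring|].
    rewrite E. ring. }
  assert (HS : forall z, unit_disk z -> schwarzian f z = (2 * q z)%C).
  { intros z Hz. rewrite (hS z Hz). unfold Rschwarz, q, ode_potential. ring. }
  pose proof (schwarzian_ode_in_disk f y q hf HS Hy hf1 hf2 hy0 hy1) as HI.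
  assert (Hnz : forall z, unit_disk z -> y z <> RtoC 0).
  { intros z Hz E. apply C1_nz. rewrite <- (proj1 (HI z Hz)), E. ring. }
  pose proof (ode_solution_real y q (fun x _ => ode_potential_real t lambda x ht)
    Hy hy0 hy1 Hnz) as Hreal.
  (* Values at 1 are the limits of those along the radius [0, 1). *)
  pose proof (analytic_C_derive _ _ hf_ext) as Af1.
  pose proof (analytic_C_derive _ _ hy_ext) as Ay1.
  pose proof (analytic_C_derive _ _ Ay1) as Ay2.
  assert (Hcont : forall g, analytic_at g (RtoC 1) -> rel_cont RtoC (fun s => g (RtoC s)) 1).
  { intros g Hg. eapply rel_deriv_cont, rel_deriv_real, analytic_derivable, Hg. }
  pose proof (Hcont _ hy_ext) as Cy. pose proof (Hcont _ Ay1) as Cy1.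
  pose proof (Hcont _ Ay2) as Cy2. pose proof (Hcont _ Af1) as Cf1.
  pose proof (Hcont _ (analytic_C_derive _ _ Af1)) as Cf2.
  assert (L1 : (y (RtoC 1) * y (RtoC 1) * C_derive f (RtoC 1) = 1)%C).
  { apply (rel_cont_left_limit (fun s => y (RtoC s) * y (RtoC s) * C_derive f (RtoC s))%C 0 1);
      [lra| |].
    - repeat apply rel_cont_mult; assumption.
    - intros x Hx. apply HI, RtoC_in_disk, Hx. }
  assert (L2 : (y (RtoC 1) * C_derive (C_derive f) (RtoC 1)
                + 2 * C_derive y (RtoC 1) * C_derive f (RtoC 1) = 0)%C).
  { apply (rel_cont_left_limit (fun s => y (RtoC s) * C_derive (C_derive f) (RtoC s)
                + 2 * C_derive y (RtoC s) * C_derive f (RtoC s))%C 0 1); [lra| |].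
    - apply rel_cont_plus; repeat apply rel_cont_mult; auto using rel_cont_const.
    - intros x Hx. apply HI, RtoC_in_disk, Hx. }
  assert (Hlim_real : forall g : C -> C, rel_cont RtoC (fun s => g (RtoC s)) 1 ->
     (forall x, 0 <= x < 1 -> Cconj (g (RtoC x)) = g (RtoC x)) ->
     g (RtoC 1) = RtoC (Re (g (RtoC 1)))).
  { intros g Cg Hg.
    assert (E : (Cconj (g (RtoC 1)) + - (1) * g (RtoC 1))%C = RtoC 0).
    { apply (rel_cont_left_limit (fun s => Cconj (g (RtoC s)) + - (1) * g (RtoC s))%C 0 1);
        [lra| |].
      - apply rel_cont_plus; [now apply rel_cont_conj|].
        apply rel_cont_mult; auto using rel_cont_const.
      - intros x Hx. rewrite Hg by exact Hx. ring. }
    apply (f_equal snd) in E. simpl in E. apply injective_projections; simpl; [reflexivity|]. lra. }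
  set (a := Re (y (RtoC 1))). set (b := Re (C_derive y (RtoC 1))).
  assert (Ea : y (RtoC 1) = RtoC a).
  { apply Hlim_real; [exact Cy|]. intros x Hx. apply Hreal, Hx. }
  assert (Eb : C_derive y (RtoC 1) = RtoC b).
  { apply Hlim_real; [exact Cy1|]. intros x Hx. apply Hreal, Hx. }
  rewrite Ea in L1, L2. rewrite Eb in L2.
  assert (Ha : a <> 0) by (intro Z; apply C1_nz; rewrite <- L1, Z; ring).
  assert (HaC : RtoC a <> RtoC 0) by (intro Z; apply Ha, RtoC_inj, Z).
  assert (Ep : C_derive f (RtoC 1) = RtoC (/ (a * a))).
  { rewrite RtoC_inv, RtoC_mult by (now apply Rmult_integral_contrapositive_currified).
    transitivity ((a * a * C_derive f 1) / (a * a))%C; [field; exact HaC|].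
    rewrite L1. field. exact HaC. }
  assert (Eq : C_derive (C_derive f) (RtoC 1) = RtoC (-2 * b / (a * a * a))).
  { rewrite RtoC_div, !RtoC_mult by (repeat apply Rmult_integral_contrapositive_currified; exact Ha).
    rewrite Ep, RtoC_inv, RtoC_mult in L2 by (now apply Rmult_integral_contrapositive_currified).
    transitivity ((a * C_derive (C_derive f) 1 + 2 * b * / (a * a)) / a - 2 * b / (a * a * a))%C;
      [field; exact HaC|].
    rewrite L2. field. exact HaC. }
  assert (Hpne : / (a * a) <> 0)
    by (apply Rinv_neq_0_compat; now apply Rmult_integral_contrapositive_currified).
  destruct hP as [_ [HImA [Hedges _]]].
  destruct (Hedges 0%nat ltac:(lia)) as [Hprop [Hend0 Hend1]].
  assert (Hkappa : kappa = (/ (a * a) + -2 * b / (a * a * a)) / (/ (a * a)) ^ 2).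
  { apply (curvature_of_right_edge (e 0%nat) A f t); auto; [lra|].
    intros theta Htheta. apply hright. exists theta. auto. }
  assert (Hkappa' : kappa = a ^ 2 - 2 * a * b) by (rewrite Hkappa; field; exact Ha).
  assert (Hkappa_y : RtoC kappa = (y (RtoC 1) ^ 2 - 2 * y (RtoC 1) * C_derive y (RtoC 1))%C).
  { rewrite Ea, Eb, Hkappa', RtoC_minus, !RtoC_mult, RtoC_pow. reflexivity. }
  split; [|split; [|split]].
  - intros z Hz. split; [now apply Hnz|].
    unfold is_segment_integral.
    replace (f z) with (f (z * RtoC 1) - f (z * RtoC 0))%C.
    2:{ replace (z * RtoC 1)%C with z by ring. replace (z * RtoC 0)%C with (RtoC 0) by ring.
        rewrite hf0. ring. }
    apply (C_is_RInt_derive (fun s => f (z * RtoC s)%C)); [lra| |].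
    + intros s Hs. pose proof (Cmod_scaled_in_disk z s Hs Hz) as Ds.
      replace (0 + s * (z - 0))%C with (z * RtoC s)%C by ring.
      eapply rel_deriv_eq; [apply rel_deriv_radius, analytic_derivable, hf, Ds|].
      pose proof (Hnz _ Ds) as Ns. destruct (HI _ Ds) as [HI1 _].
      transitivity (z * (y (z * s) * y (z * s) * C_derive f (z * s)) / (y (z * s) ^ 2))%C;
        [field; exact Ns|]. rewrite HI1. field. exact Ns.
    + intros s Hs. pose proof (Cmod_scaled_in_disk z s Hs Hz) as Ds.
      apply rel_cont_mult; [|apply rel_cont_const].
      assert (E0 : (0 + s * (z - 0))%C = (z * RtoC s)%C) by ring.
      apply (rel_cont_inv RtoC (fun s => y (0 + RtoC s * (z - 0))%C ^ 2)%C).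
      * apply Cpow_nz. rewrite E0. apply Hnz, Ds.
      * apply rel_cont_pow. apply (rel_cont_comp RtoC (fun s => 0 + RtoC s * (z - 0))%C).
        -- rewrite E0. eapply rel_deriv_cont, Hy, Ds.
        -- apply rel_cont_plus; [apply rel_cont_const|].
           apply rel_cont_mult; [apply rel_cont_base|apply rel_cont_const].
  - rewrite Ep, Eq, Hkappa, RtoC_div, RtoC_plus, RtoC_pow
      by (apply pow_nonzero; exact Hpne). reflexivity.
  - exact Hkappa_y.
  - exists (fun x => C_derive y (RtoC x)), (fun x => - q (RtoC x) * y (RtoC x))%C.
    split; [|split; [exact hy0|split; [exact hy1|symmetry; exact Hkappa_y]]].
    assert (Hy' : forall x, 0 <= x <= 1 ->
      rel_deriv (fun w => w) y (RtoC x) (C_derive y (RtoC x)) /\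
      rel_deriv (fun w => w) (C_derive y) (RtoC x) (- q (RtoC x) * y (RtoC x))%C).
    { intros x Hx. destruct (Req_dec x 1) as [->|n]; [|apply Hy, RtoC_in_disk; lra].
      (* At the endpoint the equation is the limit of the one inside. *)
      split; [now apply analytic_derivable|].
      eapply rel_deriv_eq; [now apply analytic_derivable|].
      assert (E : (C_derive (C_derive y) 1 + q 1 * y 1 = 0)%C).
      { apply (rel_cont_left_limit (fun s => C_derive (C_derive y) (RtoC s)
          + q (RtoC s) * y (RtoC s))%C 0 1); [lra| |].
        - apply rel_cont_plus; [exact Cy2|]. apply rel_cont_mult; [|exact Cy].
          now apply ode_potential_continuous.
        - intros v Hv.
          rewrite (C_derive_rel _ _ _ (proj2 (Hy _ (RtoC_in_disk v Hv)))). ring. }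
      transitivity (C_derive (C_derive y) 1 + q 1 * y 1 - q 1 * y 1)%C; [ring|].
      rewrite E. ring. }
    intros x Hx. destruct (Hy' x Hx) as [D1 D2].
    split; [apply R_is_derive_rel, rel_deriv_real, D1|].
    split; [apply R_is_derive_rel, (rel_deriv_real (C_derive y)), D2|].
    unfold q, ode_potential. ring.
Qed.
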